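(* Let $K\subset[0,\infty)$ be infinite, countable, closed, and contain $0$, with the Euclidean metric and base point $0$. Then $$E_{\rm gap}(K)=S(K)$$ isometrically (equality as subspaces of $\operatorname{Lip}_0(K)$, both with the norm $\|\cdot\|_{\operatorname{Lip}}$). Consequently, $$S(K)^*\cong\mathcal F(K),\qquad S(K)^{**}\cong\operatorname{Lip}_0(K)$$ canonically and isometrically; that is, the restriction map $\mathcal F(K)\to S(K)^*$, $\eta\mapsto\eta|_{S(K)}$, is an isometric isomorphism, and hence so is its adjoint $S(K)^{**}\to\mathcal F(K)^*=\operatorname{Lip}_0(K)$.
   Context: All Banach spaces are real; $B(x,r)$ denotes the closed ball. For a pointed metric space $(M,d,0)$, $\operatorname{Lip}_0(M)$ is the Banach space of Lipschitz $f:M\to\mathbb R$ with $f(0)=0$, with norm $\|f\|_{\operatorname{Lip}}=\sup_{x\ne y}|f(x)-f(y)|/d(x,y)$, and $\mathcal F(M)=\overline{\operatorname{span}}\{\delta(x):x\in M\}\subset\operatorname{Lip}_0(M)^*$, where $\langle f,\delta(x)\rangle=f(x)$, is the Lipschitz-free space; $\mathcal F(M)^*=\operatorname{Lip}_0(M)$ isometrically and canonically. For $K$ as in the claim let $R_K=\sup K\in(0,\infty]$, and $I_K=[0,R_K]$ if $R_K<\infty$, $I_K=[0,\infty)$ if $R_K=\infty$. $\mathcal G(K)$ is the (countably infinite) family of bounded connected components of $I_K\setminus K$; each $I\in\mathcal G(K)$ is an open interval $(a_I,b_I)$ with $a_I<b_I$ in $K$. Fix an enumeration $\mathcal G(K)=\{I_j:j\in\mathbb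 N\}$. For $f\in\operatorname{Lip}_0(K)$ put $\Delta_I f=\dfrac{f(b_I)-f(a_I)}{b_I-a_I}$, and $$E_{\rm gap}(K)=\{f\in\operatorname{Lip}_0(K):(\Delta_{I_j}f)_{j\in\mathbb N}\in c_0\}.$$ The little Lipschitz space $\operatorname{lip}_0(K)$ consists of those $f\in\operatorname{Lip}_0(K)$ such that for every $\varepsilon>0$ there is $\delta>0$ with $|f(x)-f(y)|\le\varepsilon|x-y|$ whenever $x,y\in K$, $0<|x-y|<\delta$. Dalet's space is $$S(K)=\left\{f\in\operatorname{lip}_0(K):\lim_{r\to\infty}\ \sup_{\substack{x\text{ or }y\notin B(0,r)\\ x\ne y}}\frac{|f(x)-f(y)|}{|x-y|}=0\right\},$$ the supremum being over $x,y\in K$; when $K$ is bounded the second condition is void (supremum over the empty set is $0$). *)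

(* Defs.v *)
From HB Require Import structures.
From mathcomp Require Import finmap.
From mathcomp Require Import all_boot all_order all_algebra.
From mathcomp Require Import all_classical all_reals all_analysis.
Set Implicit Arguments.
Unset Strict Implicit.
Unset Printing Implicit Defensive.
Import Order.TTheory GRing.Theory Num.Theory.
Import numFieldNormedType.Exports.
Local Open Scope classical_set_scope.
Local Open Scope ring_scope.

Section sup_image.
Context {R : realType} (I : Type) (D : set I).
Implicit Types (g : I -> R) (c : R).

Lemma sup_image_le g c : 0 <= c -> (forall i, D i -> g i <= c) ->
  sup (g @` D) <= c.
Proof.
move=> c0 gc; have [->|/set0P D0] := eqVneq (g @` D) set0; first by rewrite sup0.
by apply: ge_sup => // _ [i Di <-]; exact: gc.
Qed.

Lemma sup_image_ub g c i : (forall i, D i -> g i <= c) -> D i ->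
  g i <= sup (g @` D).
Proof.
by move=> gc Di; apply: ub_le_sup; [exists c => _ [j Dj <-]; exact: gc|exists i].
Qed.

Lemma sup_image_ge0 g c : (forall i, D i -> 0 <= g i <= c) ->
  0 <= sup (g @` D).
Proof.
move=> gc; have [->|/set0P[_ [i Di _]]] := eqVneq (g @` D) set0.
  by rewrite sup0.
have gc' j : D j -> g j <= c by move=> /gc/andP[].
by rewrite (le_trans _ (sup_image_ub gc' Di))//; have /andP[] := gc _ Di.
Qed.

End sup_image.

Section normed_subspace.
Context {R : realType} {V : normedModType R} (S : submodClosed V).

Definition normed_subspace : Type := {x : V | x \in S}.

HB.instance Definition _ := SubChoice.on normed_subspace.
HB.instance Definition _ := [SubChoice_isSubLmodule of normed_subspace by <:].

Definition normed_subspace_val (x : normed_subspace) : V := \val x.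

Let norm (x : normed_subspace) : R := `|\val x|.

Let ler_normD x y : norm (x + y) <= norm x + norm y.
Proof. by rewrite /norm raddfD/= ler_normD. Qed.

Let normrZ (l : R) x : norm (l *: x) = `|l| * norm x.
Proof. by rewrite /norm linearZ/= normrZ. Qed.

Let normr0_eq0 x : norm x = 0 -> x = 0.
Proof. by move=> /normr0_eq0 x0; apply: val_inj; rewrite x0 raddf0. Qed.

HB.instance Definition _ :=
  Lmodule_isNormed.Build R normed_subspace ler_normD normrZ normr0_eq0.

Lemma normed_subspace_normE (x : normed_subspace) : `|x| = `|\val x|.
Proof. by []. Qed.

End normed_subspace.

Section continuous_linear.
Context {R : realType}.
Implicit Types U V W : normedModType R.

Definition clin_pred V W : {pred V -> W} :=
  fun f => `[< linear f /\ continuous f >].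

Lemma clin_submod_closed V W : submod_closed (@clin_pred V W).
Proof.
split=> [|l f g /asboolP[fl fc] /asboolP[gl gc]].
  by apply/asboolP; split=> [a x y|x]; [rewrite /= scaler0 addr0|exact: cvg_cst].
apply/asboolP; split=> [a x y|x].
  rewrite !fctE fl gl !scalerDr !scalerA mulrC -!addrA; congr (_ + _).
  by rewrite addrCA.
by apply: cvgD; [apply: cvgZr; exact: fc|exact: gc].
Qed.

HB.instance Definition _ V W :=
  GRing.isSubmodClosed.Build R (V -> W) (@clin_pred V W)
    (@clin_submod_closed V W).

Definition clin V W : Type := {f : V -> W | f \in @clin_pred V W}.

HB.instance Definition _ V W := SubChoice.on (clin V W).
HB.instance Definition _ V W := [SubChoice_isSubLmodule of clin V W by <:].

Definition Clin V W (f : V -> W) (fP : f \in @clin_pred V W) : clin V W :=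
  exist _ f fP.

Definition clin_fun V W (f : clin V W) : V -> W := \val f.
Local Notation dual R V := (clin V R).

Coercion clin_fun : clin >-> Funclass.

Lemma clin_linear V W (f : clin V W) : linear f.
Proof. by have /asboolP[] := valP f. Qed.

Lemma clin_continuous V W (f : clin V W) : continuous f.
Proof. by have /asboolP[] := valP f. Qed.

Lemma clin_bounded V W (f : clin V W) :
  exists2 c : R, 0 <= c & forall x, `|f x| <= c * `|x|.
Proof.
pose fl := GRing.isLinear.Build R V W *:%R f (@clin_linear _ _ f).
pose F : {linear V -> W} := HB.pack (f : V -> W) fl.
have := (linear_bounded_continuous F).2 (@clin_continuous _ _ f).
move=> /linear_boundedP[c [cr cf]].
exists (`|c| + 1) => [|x]; first by rewrite addr_ge0.
by apply: cf; rewrite (le_lt_trans (ler_norm c))// ltrDl.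
Qed.

Lemma bounded_clin V W (f : V -> W) (c : R) :
  linear f -> (forall x, `|f x| <= c * `|x|) -> f \in @clin_pred V W.
Proof.
move=> lf cf; apply/asboolP; split=> //.
pose fl := GRing.isLinear.Build R V W *:%R f lf.
pose F : {linear V -> W} := HB.pack f fl.
apply: (@bounded_linear_continuous _ _ _ F).
apply/linear_boundedP; exists c; split=> [|r cr x]; first exact: num_real.
by rewrite (le_trans (cf x))// ler_wpM2r// ltW.
Qed.

Let norm V W (f : clin V W) : R :=
  sup [set `|f x| | x in [set x : V | `|x| <= 1]].

Let norm_bounded V W (f : clin V W) :
  exists c, forall x, [set x : V | `|x| <= 1] x -> 0 <= `|f x| <= c.
Proof.
have [c c0 cf] := clin_bounded f; exists c => x /= x1.
by rewrite normr_ge0/= (le_trans (cf x))// ler_piMr.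
Qed.

Let norm_ge0 V W (f : clin V W) : 0 <= norm f.
Proof. by have [c cf] := norm_bounded f; exact: sup_image_ge0 cf. Qed.

Let norm_ub1 V W (f : clin V W) x : `|x| <= 1 -> `|f x| <= norm f.
Proof.
have [c cf] := norm_bounded f.
move=> x1; apply: (@sup_image_ub _ _ _ (fun y => `|f y|) c) => [y|//].
by move=> /cf/andP[].
Qed.

Let norm_ub V W (f : clin V W) x : `|f x| <= norm f * `|x|.
Proof.
have fZ l y : f (l *: y) = l *: f y.
  have := clin_linear f l y 0; rewrite !addr0 => ->.
  have := clin_linear f 1 0 0; rewrite !scale1r addr0.
  by move=> /eqP; rewrite -subr_eq subrr => /eqP <-; rewrite addr0.
have [->|x0] := eqVneq x 0.
  by rewrite -(scale0r (0 : V)) fZ !scale0r !normr0 mulr0.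
rewrite -ler_pdivrMr ?normr_gt0// mulrC.
rewrite -[X in X * _](ger0_norm (ltW _)) ?invr_gt0 ?normr_gt0// -normrZ -fZ.
by apply: norm_ub1; rewrite normrZ normfV normr_id mulVf ?normr_eq0.
Qed.

Section clin_norm.
Variables V W : normedModType R.
Implicit Types f g : clin V W.

Let ler_normD f g : norm (f + g) <= norm f + norm g.
Proof.
apply: sup_image_le; first by rewrite addr_ge0// norm_ge0.
move=> x /= x1; rewrite (le_trans (ler_normD (f x) (g x)))//.
by rewrite lerD// norm_ub1.
Qed.

Let normZ_le (l : R) f : norm (l *: f) <= `|l| * norm f.
Proof.
apply: sup_image_le; first by rewrite mulr_ge0// norm_ge0.
move=> x /= x1; rewrite [X in `|X|](_ : _ = l *: f x)// normrZ.
by rewrite ler_wpM2l// norm_ub1.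
Qed.

Let normrZ (l : R) f : norm (l *: f) = `|l| * norm f.
Proof.
apply/eqP; rewrite eq_le normZ_le/=; have [->|l0] := eqVneq l 0.
  by rewrite normr0 mul0r norm_ge0.
rewrite -ler_pdivlMl ?normr_gt0// -normfV.
by rewrite -[f in X in X <= _](scalerK l0) normZ_le.
Qed.

Let normr0_eq0 f : norm f = 0 -> f = 0.
Proof.
move=> f0; apply/val_inj/funext => x; apply/normr0_eq0/eqP.
by rewrite eq_le normr_ge0 andbT (le_trans (norm_ub f x))// f0 mul0r.
Qed.

HB.instance Definition _ :=
  Lmodule_isNormed.Build R (clin V W) ler_normD normrZ normr0_eq0.

End clin_norm.

Lemma clin_normE V W (f : clin V W) :
  `|f| = sup [set `|f x| | x in [set x : V | `|x| <= 1]].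
Proof. by []. Qed.

Lemma clin_norm_ub V W (f : clin V W) x : `|f x| <= `|f| * `|x|.
Proof. exact: norm_ub. Qed.

Lemma clin_norm_le V W (f : clin V W) c : 0 <= c ->
  (forall x, `|f x| <= c * `|x|) -> `|f| <= c.
Proof.
move=> c0 cf; apply: sup_image_le => // x /= x1.
by rewrite (le_trans (cf x))// ler_piMr.
Qed.

Lemma clin_comp_subproof U V W (g : clin V W) (f : clin U V) :
  g \o f \in @clin_pred U W.
Proof.
apply/asboolP; split=> [a x y|x].
  by rewrite /= (clin_linear f) (clin_linear g).
by apply: continuous_comp; exact: clin_continuous.
Qed.

Definition clin_comp U V W (g : clin V W) (f : clin U V) : clin U W :=
  Clin (clin_comp_subproof g f).

Lemma clin_incl_subproof V (S : submodClosed V) :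
  @normed_subspace_val R V S \in @clin_pred (normed_subspace S) V.
Proof.
by apply: (@bounded_clin _ _ _ 1) => [a x y//|x]; rewrite mul1r.
Qed.

Definition clin_incl V (S : submodClosed V) : clin (normed_subspace S) V :=
  Clin (clin_incl_subproof S).

Lemma clin_linE V W (l : R) (f g : clin V W) x :
  clin_fun (l *: f + g) x = l *: f x + g x.
Proof. by []. Qed.

Lemma dual_eval_subproof V (x : V) :
  (fun phi : dual R V => phi x) \in @clin_pred (dual R V) R.
Proof.
apply: (@bounded_clin _ _ _ `|x|) => [l f g|f]; first by rewrite clin_linE.
by rewrite mulrC; exact: clin_norm_ub.
Qed.

Definition dual_eval V (x : V) : dual R (dual R V) := Clin (dual_eval_subproof x).

Lemma adjoint_subproof V W (T : clin V W) :
  (fun phi : dual R W => clin_comp phi T) \in @clin_pred (dual R W) (dual R V).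
Proof.
apply: (@bounded_clin _ _ _ `|T|) => [l f g|f].
  by apply/val_inj/funext => x; rewrite /= clin_linE.
rewrite mulrC; apply: clin_norm_le => [|x]; first by rewrite mulr_ge0.
rewrite /= (le_trans (clin_norm_ub f _))// -mulrA ler_wpM2l//.
Qed.

Definition adjoint V W (T : clin V W) : clin (dual R W) (dual R V) :=
  Clin (adjoint_subproof T).

Definition isometric_isomorphism V W (T : V -> W) : Prop :=
  [/\ linear T, (forall x, `|T x| = `|x|) & bijective T].

Definition linear_span V (A : set V) : set V :=
  [set v | exists2 s : seq (R * V), (forall p, p \in s -> A p.2) &
    v = \sum_(p <- s) p.1 *: p.2].

Definition closed_span V (A : set V) : {pred V} :=
  mem (closure (linear_span A)).

Lemma closed_span_submod_closed V (A : set V) :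
  submod_closed (@closed_span V A).
Proof.
have lin (l : R) u v : linear_span A u -> linear_span A v ->
    linear_span A (l *: u + v).
  move=> [s sA ->] [t tA ->].
  exists ([seq (l * p.1, p.2) | p <- s] ++ t) => [p|].
    by rewrite mem_cat => /orP[/mapP[q qs ->]/=|]; [exact: sA|exact: tA].
  rewrite big_cat big_map scaler_sumr/=; congr (_ + _).
  by apply: eq_bigr => p _; rewrite scalerA.
split.
  by rewrite inE; apply: subset_closure; exists [::]; rewrite ?big_nil.
move=> l u v; rewrite !inE => Au Av B nB.
have : (fun p : V * V => l *: p.1 + p.2) x @[x --> (u, v)] --> l *: u + v.
  by apply: cvgD; [apply: cvgZr; exact: cvg_fst|exact: cvg_snd].
move=> /(_ B nB)[[B1 B2] /= [/Au[x [Ax xB1]] /Av[y [Ay yB2]]] BB].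
by exists (l *: x + y); split; [exact: lin|apply: (BB (x, y))].
Qed.

HB.instance Definition _ V (A : set V) :=
  GRing.isSubmodClosed.Build R V (@closed_span V A)
    (@closed_span_submod_closed V A).

End continuous_linear.

Notation dual R V := (@clin R V R).

(* The library only equips the type of a subset with a pseudometric. *)
Section subset_metric.
Context {R : realType} {V : normedModType R} (A : set V).

Let dist (x y : A) : R := `|\val x - \val y|.

Let dist_ge0 (x y : A) : 0 <= dist x y.
Proof. exact: normr_ge0. Qed.

Let dist_positivity (x y : A) : dist x y = 0 -> x = y.
Proof. by move/normr0_eq0/eqP; rewrite subr_eq0 => /eqP/val_inj. Qed.

Let ballEdist (x : A) e : ball x e = [set y | dist x y < e].
Proof. by rewrite {1}/ball/= /initial_ball/= -ball_normE. Qed.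

HB.instance Definition _ :=
  PseudoMetric_isMetric.Build R A dist_ge0 dist_positivity ballEdist.

Lemma mdist_subsetE (x y : A) : mdist x y = `|\val x - \val y|.
Proof. by []. Qed.

End subset_metric.

Section lipschitz.
Context {R : realType} {M : metricType R} (o : M).

Definition slope (f : M -> R) (p : M * M) : R :=
  `|f p.1 - f p.2| / mdist p.1 p.2.

Definition lip0_pred : {pred M -> R} := fun f =>
  `[< f o = 0 /\ exists L : R, forall x y, `|f x - f y| <= L * mdist x y >].

Lemma lip0_submod_closed : submod_closed lip0_pred.
Proof.
split=> [|l f g /asboolP[f0 [L fL]] /asboolP[g0 [L' gL]]]; apply/asboolP.
  by split=> //; exists 0 => x y; rewrite subrr normr0 mul0r.
split; first by rewrite !fctE f0 g0 scaler0 addr0.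
exists (`|l| * L + L') => x y; rewrite !fctE opprD addrACA -scalerBr mulrDl.
rewrite (le_trans (ler_normD _ _))// lerD// normrM -mulrA.
by rewrite ler_wpM2l.
Qed.

HB.instance Definition _ :=
  GRing.isSubmodClosed.Build R (M -> R) lip0_pred lip0_submod_closed.

Definition lip0 : Type := {f : M -> R | f \in lip0_pred}.

HB.instance Definition _ := SubChoice.on lip0.
HB.instance Definition _ := [SubChoice_isSubLmodule of lip0 by <:].

Definition lip0_fun (f : lip0) : M -> R := \val f.
Coercion lip0_fun : lip0 >-> Funclass.

Implicit Types f g : lip0.

Lemma lip0_base f : f o = 0.
Proof. by have /asboolP[] := valP f. Qed.

Let slope_sup (D : set (M * M)) f : R := sup (slope f @` D).

Let slope_bounded f : exists c, forall p, 0 <= slope f p <= c.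
Proof.
have /asboolP[_ [L fL]] := valP f; exists `|L| => p.
rewrite /slope divr_ge0 ?mdist_ge0//=; have [->|p12] := eqVneq p.1 p.2.
  by rewrite mdistxx invr0 mulr0.
rewrite ler_pdivrMr ?mdist_gt0// (le_trans (fL _ _))//.
by rewrite ler_wpM2r ?mdist_ge0// ler_norm.
Qed.

Let slope_sup_ge0 D f : 0 <= slope_sup D f.
Proof.
by have [c cf] := slope_bounded f; apply: (@sup_image_ge0 _ _ _ _ c).
Qed.

Let slope_sup_ub D f p : D p -> slope f p <= slope_sup D f.
Proof.
have [c cf] := slope_bounded f; move=> Dp.
by apply: (@sup_image_ub _ _ _ _ c) => // q _; have /andP[] := cf q.
Qed.

Let slope_sup_lin D l f g :
  slope_sup D (l *: f + g) <= `|l| * slope_sup D f + slope_sup D g.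
Proof.
apply: sup_image_le => [|p Dp].
  by rewrite addr_ge0 ?mulr_ge0 ?slope_sup_ge0.
apply: (@le_trans _ _ (`|l| * slope f p + slope g p)); last first.
  by rewrite lerD ?ler_wpM2l ?slope_sup_ub.
rewrite /slope mulrA -mulrDl ler_wpM2r ?invr_ge0 ?mdist_ge0//.
rewrite [X in `|X|](_ : _ = l * (f p.1 - f p.2) + (g p.1 - g p.2)).
  by rewrite (le_trans (ler_normD _ _))// normrM.
by rewrite mulrBr addrACA -opprD.
Qed.

Let norm f : R := slope_sup [set p | p.1 != p.2] f.

Let norm_ub f x y : `|f x - f y| <= norm f * mdist x y.
Proof.
have [->|xy] := eqVneq x y; first by rewrite subrr normr0 mdistxx mulr0.
by rewrite -ler_pdivrMr ?mdist_gt0// (@slope_sup_ub _ f (x, y)).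
Qed.

Let ler_normD f g : norm (f + g) <= norm f + norm g.
Proof.
by have := slope_sup_lin [set p | p.1 != p.2] 1 f g;
  rewrite scale1r normr1 mul1r.
Qed.

Let norm0 : norm 0 = 0.
Proof.
apply/eqP; rewrite eq_le slope_sup_ge0 andbT; apply: sup_image_le => // p _.
by rewrite /slope [X in `|X|]subrr normr0 mul0r.
Qed.

Let normZ_le (l : R) f : norm (l *: f) <= `|l| * norm f.
Proof.
have := slope_sup_lin [set p | p.1 != p.2] l f 0.
by rewrite addr0 -!/(norm _) norm0 addr0.
Qed.

Let normrZ (l : R) f : norm (l *: f) = `|l| * norm f.
Proof.
apply/eqP; rewrite eq_le normZ_le/=; have [->|l0] := eqVneq l 0.
  by rewrite normr0 mul0r slope_sup_ge0.
rewrite -ler_pdivlMl ?normr_gt0// -normfV.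
by rewrite -[f in X in X <= _](scalerK l0) normZ_le.
Qed.

Let normr0_eq0 f : norm f = 0 -> f = 0.
Proof.
move=> f0; apply/val_inj/funext => x; apply/normr0_eq0/eqP.
rewrite eq_le normr_ge0 andbT; have := norm_ub f x o.
by rewrite lip0_base subr0 f0 mul0r.
Qed.

HB.instance Definition _ :=
  Lmodule_isNormed.Build R lip0 ler_normD normrZ normr0_eq0.

Lemma lip0_normE f :
  `|f| = sup [set `|f p.1 - f p.2| / mdist p.1 p.2
             | p in [set p : M * M | p.1 != p.2]].
Proof. by []. Qed.

Lemma lip0_norm_ub f x y : `|f x - f y| <= `|f| * mdist x y.
Proof. exact: norm_ub. Qed.

Lemma delta_subproof (x : M) : (fun f : lip0 => f x) \in @clin_pred R lip0 R.
Proof.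
apply: (@bounded_clin _ _ _ _ (mdist x o)) => [l f g//|f].
by have := lip0_norm_ub f x o; rewrite lip0_base subr0 mulrC.
Qed.

Definition delta (x : M) : dual R lip0 := Clin (delta_subproof x).

Local Notation lipfree := (normed_subspace (closed_span (range delta))).

(* The canonical identification f |-> (eta |-> eta f) of Lip_0(M) with the
   dual of the free space. *)
Definition lip0_dual f : dual R lipfree :=
  clin_comp (dual_eval f) (clin_incl (closed_span (range delta))).

(* The library's [closed_ball] is the closure of the open ball, which may be
   strictly smaller in a general metric space. *)
Definition cball (x : M) (r : R) : set M := [set y | mdist x y <= r].

Definition little_lip f : Prop :=
  forall e : R, 0 < e -> exists2 d : R, 0 < d &
    forall x y, 0 < mdist x y < d -> `|f x - f y| <= e * mdist x y.

(* The slopes are bounded by the norm of f, and [sup set0 = 0], so the condition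
   holds trivially when M is bounded. *)
Definition flat_at_infinity f : Prop :=
  sup [set slope f p | p in [set p : M * M |
    (~ cball o r p.1 \/ ~ cball o r p.2) /\ p.1 != p.2]] @[r --> +oo]
  --> (0 : R).

Definition dalet : {pred lip0} :=
  fun f => `[< little_lip f /\ flat_at_infinity f >].

Lemma dalet_submod_closed : submod_closed dalet.
Proof.
split=> [|l f g /asboolP[fl fi] /asboolP[gl gi]]; apply/asboolP; split.
- by move=> e e0; exists 1 => // x y _; rewrite subrr normr0 mulr_ge0 ?mdist_ge0 ?ltW.
- rewrite /flat_at_infinity [X in X @ _](_ : _ = cst 0); first exact: cvg_cst.
  apply/funext => r; apply/eqP.
  rewrite eq_le [X in _ && X]slope_sup_ge0 andbT.
  apply: sup_image_le => // p _.
  by rewrite /slope [X in `|X|]subrr normr0 mul0r.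
- move=> e e0; have c0 : 0 < `|l| + 1 :> R by rewrite ltr_wpDl.
  have [d d0 fd] := fl _ (divr_gt0 e0 (mulr_gt0 (ltr0n R 2) c0)).
  have [d' d'0 gd] := gl _ (divr_gt0 e0 (ltr0n R 2)).
  exists (Num.min d d') => [|x y]; first by rewrite lt_min d0.
  rewrite lt_min => /and3P[xy xyd xyd'].
  rewrite [X in `|X|](_ : _ =
      l * (lip0_fun f x - lip0_fun f y) + (lip0_fun g x - lip0_fun g y));
    last first.
    by rewrite mulrBr addrACA -opprD.
  rewrite (le_trans (Num.Theory.ler_normD _ _))// (splitr e) mulrDl lerD//.
    rewrite normrM; have := fd x y; rewrite xy xyd => /(_ isT) fxy.
    rewrite (le_trans (ler_wpM2l _ fxy))// mulrA ler_wpM2r ?mdist_ge0//.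
    rewrite invfM (mulrA e) mulrCA ler_piMr ?divr_ge0 ?ltW//.
    by rewrite ltr_pdivrMr// mul1r ltrDl.
  by apply: gd; rewrite xy.
- apply: (@squeeze_cvgr _ _ _ _ (cst 0) (fun r : R => `|l| *
      slope_sup [set p | (~ cball o r p.1 \/ ~ cball o r p.2) /\ p.1 != p.2] f
    + slope_sup [set p | (~ cball o r p.1 \/ ~ cball o r p.2) /\ p.1 != p.2] g)).
  + by near=> r; rewrite slope_sup_ge0 slope_sup_lin.
  + exact: cvg_cst.
  + rewrite -[X in _ --> X](addr0 (0 : R)) -[X in _ --> X + _](mulr0 `|l|).
    by apply: cvgD => //; apply: cvgMr.
Unshelve. all: by end_near. Qed.

HB.instance Definition _ :=
  GRing.isSubmodClosed.Build R lip0 dalet dalet_submod_closed.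

Local Notation dalet_space := (normed_subspace dalet).

(* eta |-> eta restricted to the subspace [dalet], as a composition of
   [adjoint (clin_incl dalet)] with the inclusion of the free space. *)
Definition free_restriction : clin lipfree (dual R dalet_space) :=
  clin_comp (adjoint (clin_incl dalet))
            (clin_incl (closed_span (range delta))).

Lemma free_restrictionE (eta : lipfree) (f : dalet_space) :
  clin_fun (free_restriction eta) f =
  clin_fun (normed_subspace_val eta) (normed_subspace_val f).
Proof. by []. Qed.

Lemma lip0_dualE f (eta : lipfree) :
  lip0_dual f eta = clin_fun (normed_subspace_val eta) f.
Proof. by []. Qed.

End lipschitz.

Arguments dalet {R M} o _.
Notation lipfree o := (normed_subspace (closed_span (range (delta o)))).
Notation dalet_space o := (normed_subspace (dalet o)).

Section gaps.
Context {R : realType}.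
Implicit Types K : set R.

(* This is [0, sup K] if K is bounded above and [0, +oo) otherwise, since the
   supremum is taken in the extended reals. *)
Definition hull0 K : set R :=
  [set x | 0 <= x /\ (x%:E <= ereal_sup [set y%:E | y in K])%E].

Definition gaps K : set (set R) :=
  [set I | bounded_set I /\
    exists2 x, (hull0 K `\` K) x & I = connected_component (hull0 K `\` K) x].

(* The endpoints are given in the type of K, where functions in Lip_0(K) are
   defined; a j < b j follows as components are nonempty. *)
Definition gap_enum K (a b : nat -> K) : Prop :=
  set_bij [set: nat] (gaps K) (fun j => `]\val (a j), \val (b j)[%classic).

Definition Egap K (o : K) (a b : nat -> K) : {pred lip0 o} := fun f =>
  `[< (f (b j) - f (a j)) / (\val (b j) - \val (a j)) @[j --> \oo]
      --> (0 : R) >].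

End gaps.

Arguments Egap {R K} o a b _.

Section gap_enum_exists.
Context {R : realType} (K : set R).
Context (K_ge0 : forall x : R, K x -> 0 <= x) (K0 : K 0).
Context (K_infinite : infinite_set K) (K_countable : countable K).
Context (K_closed : closed K).

Let closed_inf (A : set R) : A `<=` K -> A !=set0 -> K (inf A).
Proof.
move=> AK A0; apply: K_closed => B /nbhs_ballP[e /= e0 eB].
have iA : has_inf A by split => //; exists 0 => x /AK/K_ge0.
have [k Ak ke] := inf_adherent e0 iA; exists k; split; first exact: AK.
apply: eB; rewrite /ball/= ler0_norm ?subr_le0 ?opprB ?ltrBlDl//.
by apply: ge_inf => //; case: iA.
Qed.

Let closed_sup (A : set R) : A `<=` K -> A !=set0 -> has_ubound A -> K (sup A).
Proof.
move=> AK A0 uA; apply: K_closed; apply: closureS AK _ _.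
exact: closure_sup.
Qed.

Let left x := sup [set k | K k /\ k < x].
Let right x := inf [set k | K k /\ x < k].

Let gap_endpoints x : (hull0 K `\` K) x ->
  [/\ K (left x), K (right x), left x < x, x < right x &
    forall y, left x < y < right x -> ~ K y].
Proof.
move=> [[x0 xK] nKx].
have x_gt0 : 0 < x by rewrite lt_neqAle x0 andbT; apply/eqP => x0'; rewrite -x0' in nKx.
have L0 : [set k | K k /\ k < x] !=set0 by exists 0.
have uL : has_ubound [set k | K k /\ k < x] by exists x => k [_ /ltW].
have [k Kk xk] : exists2 k, K k & x < k.
  apply: contrapT => nk; apply: nKx.
  have Kx k : K k -> k <= x.
    by move=> Kk; rewrite leNgt; apply/negP => xk; apply: nk; exists k.
  have uK : has_ubound K by exists x.
  suff -> : x = sup K by apply: closed_sup => //; exists 0.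
  apply/eqP; rewrite eq_le; apply/andP; split; last first.
    by apply: ge_sup => //; exists 0.
  rewrite -lee_fin (le_trans xK)//; apply: ge_ereal_sup => _ [k Kk <-].
  by rewrite lee_fin ub_le_sup.
have U0 : [set k | K k /\ x < k] !=set0 by exists k.
have lU : has_lbound [set k | K k /\ x < k] by exists x => ? [_ /ltW].
have KL : K (left x) by apply: closed_sup => // ? [].
have KU : K (right x) by apply: closed_inf => // ? [].
have lx : left x <= x by apply: ge_sup => // ? [_ /ltW].
have xr : x <= right x by apply: lb_le_inf => // ? [_ /ltW].
split=> //.
- by rewrite lt_neqAle lx andbT; apply: contra_notN nKx => /eqP <-.
- by rewrite lt_neqAle xr andbT; apply: contra_notN nKx => /eqP ->.
- move=> y /andP[ly yr] Ky; have [yx|xy|yx] := ltgtP y x.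
  + by move: ly; rewrite ltNge => /negP; apply; apply: ub_le_sup.
  + by move: yr; rewrite ltNge => /negP; apply; apply: ge_inf.
  + by rewrite -yx in nKx.
Qed.

Let gap_component x : (hull0 K `\` K) x ->
  connected_component (hull0 K `\` K) x = `]left x, right x[%classic.
Proof.
move=> Ux; have [Kl Kr lx xr nK] := gap_endpoints Ux; apply/seteqP; split.
- move=> y [C [Cx CU /connected_intervalP Cc] Cy]; rewrite /= in_itv/=.
  apply/andP; split; rewrite ltNge; apply/negP => yx.
  + have /CU[_] : C (left x) by apply: (Cc _ _ Cy Cx); rewrite yx ltW.
    exact.
  + have /CU[_] : C (right x) by apply: (Cc _ _ Cx Cy); rewrite yx ltW.
    exact.
- apply: connected_component_max.
  + by rewrite /= in_itv/= lx.
  + move=> y; rewrite /= in_itv/= => yI; split; last exact: nK.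
    have /andP[ly yr] := yI.
    split; first by rewrite (le_trans (K_ge0 Kl))// ltW.
    apply: le_ereal_sup_tmp; exists (right x)%:E; first by exists (right x).
    by rewrite lee_fin ltW.
  + apply/connected_intervalP => y z; rewrite /= !in_itv/=.
    move=> /andP[ly _] /andP[_ zr] t /andP[yt tz].
    by rewrite in_itv/= (lt_le_trans ly)//= (le_lt_trans tz).
Qed.

Let L : set R := left @` (hull0 K `\` K).

Let gapP x : (hull0 K `\` K) x -> gaps K `]left x, right x[%classic.
Proof.
move=> Ux; rewrite -gap_component//; split; last by exists x.
rewrite gap_component//; exists (Num.max `|left x| `|right x|).
split; first by rewrite num_real.
move=> M xM y /=; rewrite in_itv/= => /andP[ly yr].
rewrite (le_trans _ (ltW xM))// le_max.
have [y0|y0] := leP 0 y.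
  by apply/orP; right; rewrite (ger0_norm y0) (le_trans (ltW yr))// ler_norm.
have lx0 : left x < 0 by exact: lt_trans y0.
by rewrite (ltr0_norm y0) (ltr0_norm lx0) lerN2 (ltW ly).
Qed.

Let left_inj x y : (hull0 K `\` K) x -> (hull0 K `\` K) y ->
  left x = left y -> right x = right y.
Proof.
move=> /gap_endpoints[Kl Kr lx xr nK] /gap_endpoints[Kl' Kr' ly yr nK'] ll'.
have [rr'|rr'|//] := ltgtP (right x) (right y).
- by exfalso; apply: (nK' (right x)) => //; rewrite rr' -ll' (lt_trans lx xr).
- by exfalso; apply: (nK (right y)) => //; rewrite rr' ll' (lt_trans ly yr).
Qed.

Let L_infinite : infinite_set L.
Proof.
move=> Lfin; apply: K_infinite.
pose A := fset_set L.
pose phi (k : R) := [fset l in A | l < k]%fset.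
have phi_lt k k' : K k -> K k' -> k < k' -> phi k != phi k'.
  move=> Kk Kk' kk'.
  have [x xkk' nKx] : exists2 x, k < x < k' & ~ K x.
    apply: contrapT => nx.
    have : `]k, k'[%classic `<=` K.
      move=> x; rewrite /= in_itv/= => xk; apply: contrapT => nKx.
      by apply: nx; exists x.
    move=> /subset_card_le/sub_countable/(_ K_countable).
    move=> /countable_lebesgue_measure0; rewrite lebesgue_measure_itv/=.
    by rewrite lte_fin kk' => /eqP; rewrite -EFinD eqe subr_eq0 gt_eqF.
  have /andP[kx xk'] := xkk'.
  have Ux : (hull0 K `\` K) x.
    split=> //; split; first by rewrite (le_trans (K_ge0 Kk))// ltW.
    apply: le_ereal_sup_tmp; exists k'%:E; first by exists k'.
    by rewrite lee_fin ltW.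
  have [_ _ lx xr nK] := gap_endpoints Ux.
  have kl : k <= left x.
    by rewrite leNgt; apply/negP => lk; apply: (nK k) => //; rewrite lk (lt_trans kx).
  apply/eqP => /fsetP/(_ (left x)).
  have lA : left x \in A by rewrite in_fset_set// inE; exists x.
  by rewrite !inE lA/= (lt_trans lx xk') ltNge kl.
have phi_inj : {in K &, injective phi}.
  move=> k k'; rewrite !inE => Kk Kk' pkk'; have [kk'|kk'|//] := ltgtP k k'.
    by have := phi_lt _ _ Kk Kk' kk'; rewrite pkk' eqxx.
  by have := phi_lt _ _ Kk' Kk kk'; rewrite pkk' eqxx.
rewrite -(eq_finite_set (inj_card_eq phi_inj)).
apply: (@sub_finite_set _ _ [set` fpowerset A]) => [_ [k _ <-]|].
  by rewrite /= fpowersetE; apply/fsubsetP => l; rewrite !inE => /andP[].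
exact: finite_fset.
Qed.

Let L_sub : L `<=` K.
Proof. by move=> _ [x /gap_endpoints[? _ _ _ _] <-]. Qed.

(* A quantification over the enumerations of the gaps is thus not vacuous. *)
Lemma gap_enum_exists : exists a b : nat -> K, gap_enum a b.
Proof.
have LN : (L #= [set: nat])%card.
  exact: (eq_card_nat (sub_countable (subset_card_le L_sub) K_countable)).
have /card_esym/card_set_bijP[e [eL e_inj e_surj]] := LN.
have eK j : e j \in K by apply/mem_set/L_sub/eL.
have /choice[z zE] : forall j, exists z, (hull0 K `\` K) z /\ left z = e j.
  by move=> j; have [z Uz zj] := eL j I; exists z.
have bK j : right (z j) \in K.
  by apply/mem_set; have [/gap_endpoints[]] := zE j.
exists (fun j => exist _ (e j) (eK j)), (fun j => exist _ (right (z j)) (bK j)).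
split=> /=.
- by move=> j _; have [Uz <-] := zE j; exact: gapP.
- have ez j : e j < right (z j).
    have [/gap_endpoints[_ _ lx xr _] <-] := zE j.
    exact: lt_trans xr.
  move=> i j _ _ /= ij; apply: e_inj; rewrite ?inE//.
  have : inf `]e i, right (z i)[%classic = inf `]e j, right (z j)[%classic.
    by rewrite ij.
  by rewrite !inf_itv// bnd_simp.
- move=> _ [_ [x Ux ->]].
  have [j _ ej] := e_surj (left x) (imageP left Ux).
  exists j => //; rewrite gap_component// -ej; have [Uz zj] := zE j.
  by rewrite (left_inj Uz Ux)// zj.
Qed.

End gap_enum_exists.

(* Main.v *)
From HB Require Import structures.
Require Import Defs.
From mathcomp Require Import all_boot all_order all_algebra.
From mathcomp Require Import all_classical all_reals all_analysis.
From mathcomp Require Import lra.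
Set Implicit Arguments.
Unset Strict Implicit.
Unset Printing Implicit Defensive.
Import Order.TTheory GRing.Theory Num.Theory.
Import numFieldNormedType.Exports.
Local Open Scope classical_set_scope.
Local Open Scope ring_scope.

(** A Lipschitz function f on K with f x < f y increases across some gap between
x and y: as f(K) is countable, some value between f x and f y is not attained,
and f has to jump over it. Hence f is determined by its slopes across the gaps,
its norm is the supremum of their absolute values, and the slopes identify
Dalet's space with c_0, whose basis is formed by the step functions h_j with
slope 1 across the j-th gap and 0 across the others. A functional phi on Dalet's
space has absolutely summable coefficients phi(h_j), and the sum of
phi(h_j) (delta(b_j) - delta(a_j)) / (b_j - a_j) is the element of the free
space restricting to phi. The restriction map is isometric because every f is
the pointwise limit of finite combinations of the h_j with norm at most that
of f. *)

(** * Bounded operators: isometric isomorphisms, adjoints, functionals on closed spans *)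

Section bounded_operators.
Context {R : realType}.
Implicit Types V W : normedModType R.

HB.instance Definition _ V W (f : clin V W) :=
  GRing.isLinear.Build R V W *:%R (clin_fun f) (clin_linear f).

Lemma clin_inj V W (f g : clin V W) : clin_fun f =1 clin_fun g -> f = g.
Proof. by move=> fg; apply/val_inj/funext. Qed.

Lemma clin0 V W (f : clin V W) : f 0 = 0.
Proof. exact: linear0. Qed.

Lemma clinB V W (f : clin V W) x y : f (x - y) = f x - f y.
Proof. exact: linearB. Qed.

Lemma clinZ V W (f : clin V W) l x : f (l *: x) = l *: f x.
Proof. exact: linearZ. Qed.

Lemma clin_sum V W (f : clin V W) I (r : seq I) (P : pred I) (F : I -> V) :
  f (\sum_(i <- r | P i) F i) = \sum_(i <- r | P i) f (F i).
Proof. exact: linear_sum. Qed.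

Lemma linear_isometry_inj V W (T : clin V W) :
  (forall x, `|T x| = `|x|) -> injective T.
Proof.
move=> Tn x y Txy; apply/eqP; rewrite -subr_eq0 -normr_eq0 -Tn clinB.
by rewrite Txy subrr normr0.
Qed.

Lemma isometric_isomorphism_clin V W (T : clin V W) :
  (forall x, `|T x| = `|x|) -> (forall y, exists x, T x = y) ->
  isometric_isomorphism T.
Proof.
move=> Tn /choice[S TS]; split=> //; first exact: clin_linear.
exists S => // x; exact: (linear_isometry_inj Tn).
Qed.

(** Bijectivity supplies a bare function; injectivity of [T] makes it linear, and the isometry makes
    it bounded. *)
Lemma isometric_isomorphism_inv V W (T : clin V W) :
  isometric_isomorphism T ->
  exists S : clin W V, cancel T S /\ cancel S T.
Proof.
move=> [_ Tn [S TK KT]].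
have SL : linear S.
  by move=> l x y; apply: (linear_isometry_inj Tn); rewrite linearP/= !KT.
have SP : S \in @clin_pred R W V.
  by apply: (@bounded_clin _ _ _ _ 1) => // x; rewrite mul1r -Tn KT.
by exists (Clin SP).
Qed.

Lemma isometric_isomorphism_comp U V W (S : clin V W) (T : clin U V) :
  isometric_isomorphism S -> isometric_isomorphism T ->
  isometric_isomorphism (clin_comp S T).
Proof.
move=> [_ Sn Sb] [_ Tn Tb]; split; first exact: clin_linear.
  by move=> x; rewrite /= Sn Tn.
exact: bij_comp.
Qed.

Lemma isometric_isomorphism_sym V W (T : clin V W) (S : clin W V) :
  isometric_isomorphism T -> cancel S T -> isometric_isomorphism S.
Proof.
move=> [_ Tn Tb] ST; split; first exact: clin_linear.
  by move=> x; rewrite -Tn ST.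
by exists T => //; apply/(bij_can_sym Tb).
Qed.

Lemma isometric_isomorphism_adjoint V W (T : clin V W) :
  isometric_isomorphism T -> isometric_isomorphism (adjoint T).
Proof.
move=> Ti; have [_ Tn _] := Ti;
  have [S [TK KT]] := isometric_isomorphism_inv Ti.
apply: isometric_isomorphism_clin => [phi|psi].
  apply/eqP; rewrite eq_le; apply/andP; split; apply: clin_norm_le => // x.
    by rewrite -(Tn x); exact: (clin_norm_ub phi (T x)).
  have -> : clin_fun phi x = clin_fun (adjoint T phi) (S x).
    exact: (congr1 (clin_fun phi) (esym (KT x))).
  by rewrite -[in leRHS](KT x) Tn; exact: clin_norm_ub.
exists (clin_comp psi S); apply: clin_inj => x.
exact: (congr1 (clin_fun psi) (TK x)).
Qed.

Definition NormedSubspace V (S : submodClosed V) (x : V) (xS : x \in S) :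
  normed_subspace S := exist (fun v => v \in S) x xS.

(** A difference vanishing on [A] vanishes on the linear span, and elsewhere it is at most its norm
    times the distance to the span. *)
Lemma dual_eq_closed_span V (A : set V)
    (phi psi : dual R (normed_subspace (closed_span A))) :
  (forall x : normed_subspace (closed_span A), A (\val x) -> phi x = psi x) ->
    phi = psi.
Proof.
move=> eqA; apply: clin_inj => x.
have span_sub (u : V) : linear_span A u -> u \in closed_span A.
  by move=> Au; rewrite inE; apply: subset_closure.
have eq_span (y : normed_subspace (closed_span A)) : linear_span A (\val y) ->
  phi y = psi y.
  move=> [s sA yE].
  (* The induction runs over lists contained in [s], whose vectors come from [A], and over all [z],
     as [phi] only accepts elements of the subspace. *)
  suff H t (z : normed_subspace (closed_span A)) : {subset t <= s} ->
      \val z = \sum_(p <- t) p.1 *: p.2 -> phi z = psi z by exact: H yE.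
  elim: t z => [|p t IHt] z ts.
    rewrite big_nil => z0; have -> : z = 0 by exact: val_inj.
    by rewrite !clin0.
  rewrite big_cons => zE.
  have Ap : A p.2 by apply/sA/ts; rewrite mem_head.
  have p2 : p.2 \in closed_span A.
    by apply: span_sub; exists [:: (1, p.2)] => [q|];
      rewrite ?inE ?big_seq1 ?scale1r// => /eqP->.
  have zp : \val (z - p.1 *: NormedSubspace p2)
      = \sum_(q <- t) q.1 *: q.2.
    by rewrite raddfB/= linearZ/= zE scalerN addrAC subrr add0r.
  have ts' : {subset t <= s} by move=> q qt; apply: ts; rewrite in_cons qt orbT.
  have := IHt _ ts' zp.
  by rewrite !clinB !clinZ (eqA (NormedSubspace p2))// => /addIr.
apply/eqP; rewrite -subr_eq0 -normr_eq0 eq_le normr_ge0 andbT.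
apply/ler_addgt0Pr => e e0; rewrite add0r.
(* Adding 1 keeps the divisor positive even if the difference is zero. *)
have c0 : 0 < `|phi - psi| + 1 by rewrite ltr_wpDl.
have := valP x; rewrite inE => /(_ _ (nbhsx_ballx _ _ (divr_gt0 e0 c0))).
move=> [u [Au]]; rewrite -ball_normE/= => xu.
pose y : normed_subspace (closed_span A) := NormedSubspace (span_sub _ Au).
have y0 : clin_fun (phi - psi) y = 0.
  by apply: (@etrans _ _ (phi y - psi y)) => //; rewrite eq_span ?subrr.
have -> : phi x - psi x = clin_fun (phi - psi) (x - y).
  by rewrite clinB y0 subr0.
rewrite (le_trans (clin_norm_ub _ _))// normed_subspace_normE raddfB/=.
rewrite (le_trans (ler_wpM2l _ (ltW xu)))// mulrCA ler_piMr// ?ltW//.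
by rewrite ltr_pdivrMr// mul1r ltrDl.
Qed.

End bounded_operators.

(** * Lipschitz functions as the dual of the free space *)

Section lipschitz_functions.
Context {R : realType} {M : metricType R} (o : M).
Implicit Types f g : lip0 o.

Lemma lip0_norm_le f (c : R) : 0 <= c ->
  (forall x y, `|f x - f y| <= c * mdist x y) -> `|f| <= c.
Proof.
move=> c0 fc; rewrite lip0_normE; apply: sup_image_le => // p /= p12.
by rewrite ler_pdivrMr ?mdist_gt0.
Qed.

Lemma slope_le_norm f p : slope f p <= `|f|.
Proof.
rewrite /slope; have [->|p12] := eqVneq p.1 p.2.
  by rewrite subrr normr0 mul0r.
by rewrite ler_pdivrMr ?mdist_gt0//; exact: lip0_norm_ub.
Qed.

Lemma lip0_of_bound (f : M -> R) (c : R) :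
  f o = 0 -> (forall x y, `|f x - f y| <= c * mdist x y) ->
  f \in lip0_pred o.
Proof. by move=> f0 fc; apply/asboolP; split=> //; exists c. Qed.

Definition Lip0 (f : M -> R) (fP : f \in lip0_pred o) : lip0 o :=
  exist (fun h : M -> R => h \in lip0_pred o) f fP.

Lemma delta_closed_span x : delta o x \in closed_span (range (delta o)).
Proof.
rewrite inE; apply: subset_closure; exists [:: (1, delta o x)] => [p|].
  by rewrite inE => /eqP ->; exists x.
by rewrite big_seq1 scale1r.
Qed.

Definition free_delta x : lipfree o := NormedSubspace (delta_closed_span x).

Lemma norm_free_deltaB x y : `|free_delta x - free_delta y| <= mdist x y.
Proof.
apply: clin_norm_le => [|f]; first exact: mdist_ge0.
by rewrite mulrC; exact: lip0_norm_ub.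
Qed.

Lemma free_delta_base : free_delta o = 0.
Proof. by apply/val_inj/clin_inj => f; exact: lip0_base. Qed.

Lemma lip0_dual_subproof : @lip0_dual R M o \in @clin_pred R (lip0 o) (dual R
  (lipfree o)).
Proof.
apply: (@bounded_clin _ _ _ _ 1) => [l f g|f].
  by apply: clin_inj => eta; rewrite lip0_dualE linearP.
rewrite mul1r; apply: clin_norm_le => // eta.
by rewrite lip0_dualE mulrC; exact: clin_norm_ub.
Qed.

(** The preimage of [psi] is its composition with [free_delta]: a functional on the free space is
    determined by its values at the point evaluations. *)
Lemma lip0_dual_surj (psi : dual R (lipfree o)) : exists f, lip0_dual f = psi.
Proof.
have psiP : (fun x => psi (free_delta x)) \in lip0_pred o.
  apply: (@lip0_of_bound _ `|psi|) => [|x y].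
    by rewrite free_delta_base clin0.
  rewrite -clinB (le_trans (clin_norm_ub _ _))// ler_wpM2l//.
  exact: norm_free_deltaB.
exists (Lip0 psiP); apply: dual_eq_closed_span => eta [x _ xE].
have -> : eta = free_delta x by exact: val_inj.
by [].
Qed.

(** For the less immediate inequality, the functional is tested on [free_delta x - free_delta y],
    whose norm is at most the distance. *)
Lemma isometric_isomorphism_lip0_dual : isometric_isomorphism (@lip0_dual R M
  o).
Proof.
apply: (@isometric_isomorphism_clin _ _ _ (Clin lip0_dual_subproof)) => [f|];
  last exact: lip0_dual_surj.
apply/eqP; rewrite eq_le; apply/andP; split.
  apply: clin_norm_le => // eta.
  by rewrite [X in `|X|]lip0_dualE mulrC; exact: clin_norm_ub.
apply: lip0_norm_le => // x y.
rewrite [X in `|X|](_ : _ = lip0_dual f (free_delta x - free_delta y)).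
  by rewrite (le_trans (clin_norm_ub _ _))// ler_wpM2l// norm_free_deltaB.
by rewrite clinB.
Qed.

(** Pointwise convergence passes to finite combinations of evaluations, and the common bound [c]
    controls the error of approximating [eta] by them. *)
Lemma free_pointwise_cvg (eta : lipfree o) (g : nat -> lip0 o) f (c : R) :
  (forall n, `|g n| <= c) -> (forall x, g n x @[n --> \oo] --> f x) ->
  clin_fun (normed_subspace_val eta) (g n) @[n --> \oo] -->
    clin_fun (normed_subspace_val eta) f.
Proof.
move=> gc gf.
have c0 : 0 <= c by exact: le_trans (gc 0%N).
have span_cvg (u : dual R (lip0 o)) : linear_span (range (delta o)) u ->
    u (g n) @[n --> \oo] --> u f.
  move=> [s sA ->].
  elim: s sA => [_|p s IHs sA].
    rewrite big_nil; exact: cvg_cst.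
  rewrite big_cons.
  have [x _ px] : range (delta o) p.2 by apply: sA; rewrite mem_head.
  apply: (@cvgD _ _ _ _ _ (fun n => p.1 *: (clin_fun p.2 (g n)))).
    by apply: cvgZr; rewrite -px; exact: gf.
  by apply: IHs => q qs; apply: sA; rewrite in_cons qs orbT.
apply/cvgrPdist_le => e e0.
(* The norm of [f - g n] is below this constant, so replacing [eta] by [u] costs at most [e / 2]. *)
have k0 : 0 < `|f| + c + 1 by rewrite ltr_wpDl// addr_ge0.
have e2 : 0 < e / 2 by rewrite divr_gt0.
have := valP eta; rewrite inE => /(_ _ (nbhsx_ballx _ _ (divr_gt0 e2 k0))).
move=> [u [/span_cvg/cvgrPdist_le/(_ _ e2) uc]]; rewrite -ball_normE/= => xu.
near=> n.
have := clin_norm_ub (\val eta - u) (f - g n).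
set a := clin_fun (\val eta - u) _.
have aE : clin_fun (normed_subspace_val eta) f -
    clin_fun (normed_subspace_val eta) (g n) =
    a + (clin_fun u f - clin_fun u (g n)).
  have D h : clin_fun (\val eta - u) h =
    clin_fun (normed_subspace_val eta) h - clin_fun u h by [].
  by rewrite /a clinB !D; lra.
rewrite aE => ale; rewrite (le_trans (ler_normD _ _))// (splitr e) lerD//;
  last first.
  by near: n.
rewrite (le_trans ale)//.
have ng : `|f - g n| <= `|f| + c by rewrite (le_trans (ler_normB _ _))// lerD2l.
rewrite (le_trans (ler_pM _ _ (ltW xu) ng))//.
by rewrite mulrAC -mulrA ler_piMr ?ltW// ltr_pdivrMr// mul1r ltrDl.
Unshelve. all: by end_near. Qed.

End lipschitz_functions.

(** * Lipschitz functions on a countable closed set and their jumps between adjacent points *)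

Section adjacent_points.
Context {R : realType} (K : set R).
Hypotheses (K_countable : countable K) (K_closed : closed K).

(** Order-theoretic form of bounding a gap; it keeps connected components out of the increment
    estimates. *)
Definition adjacent (s t : K) : Prop :=
  \val s < \val t /\ forall k : K, \val k <= \val s \/ \val t <= \val k.

(** Closedness of [K] makes the supremum a point of [K], where [f] can be evaluated; the last clause
    lets bounds on [A] pass to it by continuity. *)
Let sup_mem (A : set K) (k0 : K) (m : R) : A k0 -> (forall k, A k ->
  \val k <= m) ->
  exists s : K, [/\ forall k, A k -> \val k <= \val s, \val s <= m &
    forall e, 0 < e -> exists2 k, A k & \val s - e < \val k].
Proof.
move=> Ak0 Am; pose B := [set \val k | k in A].
have B0 : B !=set0 by exists (\val k0), k0.
have Bm : has_ubound B by exists m => _ [k Ak <-]; exact: Am.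
have Ks : K (sup B).
  apply: K_closed; apply: (closureS _ (closure_sup B0 Bm)) => _ [k _ <-].
  exact/set_mem/valP.
exists (exist (fun v => v \in K) _ (mem_set Ks)); split=> /= [k Ak||e e0].
- by apply: ub_le_sup => //; exists k.
- by apply: ge_sup => // _ [k Ak <-]; exact: Am.
- have [_ [k Ak <-] ke] := sup_adherent e0 (conj B0 Bm).
  by exists k.
Qed.

Let inf_mem (A : set K) (k0 : K) (m : R) : A k0 -> (forall k, A k ->
  m <= \val k) ->
  exists s : K, [/\ forall k, A k -> \val s <= \val k, m <= \val s &
    forall e, 0 < e -> exists2 k, A k & \val k < \val s + e].
Proof.
move=> Ak0 Am; pose B := [set \val k | k in A].
have B0 : B !=set0 by exists (\val k0), k0.
have Bm : has_lbound B by exists m => _ [k Ak <-]; exact: Am.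
have Ks : K (inf B).
  apply: K_closed => U /nbhs_ballP[e /= e0 eU].
  have [_ [k Ak <-] ke] := inf_adherent e0 (conj B0 Bm).
  exists (\val k); split; first exact/set_mem/valP.
  apply: eU; rewrite /ball/= ler0_norm ?subr_le0 ?opprB ?ltrBlDl//.
  by apply: ge_inf => //; exists k.
exists (exist (fun v => v \in K) _ (mem_set Ks)); split=> /= [k Ak||e e0].
- by apply: ge_inf => //; exists k.
- by apply: lb_le_inf => // _ [k Ak <-]; exact: Am.
- have [_ [k Ak <-] ke] := inf_adherent e0 (conj B0 Bm).
  by exists k.
Qed.

(** A countable set is Lebesgue null, while the interval has positive measure. *)
Let avoid_range (f : K -> R) (u v : R) : u < v ->
  exists2 c, u < c < v & ~ range f c.
Proof.
move=> uv; apply: contrapT => nc.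
have sub : `]u, v[%classic `<=` range f.
  move=> c; rewrite /= in_itv/= => cI; apply: contrapT => fc.
  by apply: nc; exists c.
have KT : countable [set: K].
  have val_inj_in : {in [set: K] &, injective (\val : K ->
    R)} by move=> ? ? _ _ /val_inj.
  rewrite /countable -(card_le_eql (inj_card_eq val_inj_in)).
  apply: sub_countable K_countable; apply: subset_card_le => _ [k _ <-].
  exact/set_mem/valP.
have := sub_countable (subset_card_le sub) (sub_countable (card_image_le f _)
  KT).
move=> /countable_lebesgue_measure0; rewrite lebesgue_measure_itv/=.
by rewrite lte_fin uv => /eqP; rewrite -EFinD eqe subr_eq0 gt_eqF.
Qed.

(* The last point s of K before y with f s below the missed value is the left
   end of the gap. *)
Lemma exists_adjacent_lt (f : K -> R) (L : R) (x y : K) :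
  (forall s t, `|f s - f t| <= L * `|\val s - \val t|) ->
  \val x <= \val y -> f x < f y ->
  exists s t, [/\ adjacent s t, \val x <= \val s, \val t <= \val y & f s < f t].
Proof.
move=> fL xy fxy.
have [c /andP[xc cy] nc] := avoid_range f fxy.
have fc k : f k != c by apply/eqP => fk; apply: nc; exists k.
have close (s : K) (P : K -> Prop) : (forall e, 0 < e ->
  exists2 k, P k & `|\val s - \val k| < e) ->
    forall e, 0 < e -> exists2 k, P k & `|f s - f k| <= e.
  move=> sP e e0; have L0 : 0 < `|L| + 1 by rewrite ltr_wpDl.
  have [k Pk sk] := sP _ (divr_gt0 e0 L0); exists k => //.
  rewrite (le_trans (fL _ _))//.
  rewrite (le_trans (ler_wpM2r _ (ler_norm L)))//
    (le_trans (ler_wpM2l _ (ltW sk)))//.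
  by rewrite mulrCA ler_piMr ?ltW// ltr_pdivrMr// mul1r ltrDl.
have [||s [s_ub sy s_adh]] :=
  @sup_mem [set k | \val k <= \val y /\ f k < c] x (\val y).
- by [].
- by move=> k [].
have xs : \val x <= \val s by exact: s_ub.
have fs : f s < c.
  (* Approximation only gives [f s <= c]; strictness comes from [c] not being a value of [f]. *)
  rewrite lt_neqAle fc/=; apply/ler_addgt0Pr => e e0.
  have [e' e'0|k [/= _ fk] sk] :=
    close s [set k | \val k <= \val y /\ f k < c] _ e e0.
    have [k Ak ke] := s_adh _ e'0; exists k => //.
    by rewrite ger0_norm ?subr_ge0 ?s_ub// ltrBlDr addrC -ltrBlDr.
  by move: sk; rewrite ler_norml; lra.
have sy' : \val s < \val y.
  rewrite lt_neqAle sy andbT; apply/eqP => /val_inj sy'.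
  by move: fs; rewrite sy'; lra.
have [||t [t_lb st t_adh]] :=
  @inf_mem [set k | \val s < \val k <= \val y] y (\val s).
- by rewrite /= sy' lexx.
- by move=> k /= /andP[/ltW].
(* Maximality of [s] enters here; the bound then passes to the infimum [t]. *)
have gt_c k : \val s < \val k <= \val y -> c < f k.
  move=> /andP[sk ky]; rewrite lt_neqAle eq_sym fc/= leNgt; apply/negP => fk.
  by have := s_ub k (conj ky fk); rewrite leNgt sk.
have ty : \val t <= \val y by apply: t_lb; rewrite /= sy' lexx.
have ft : c < f t.
  rewrite lt_neqAle eq_sym fc/=; apply/ler_addgt0Pr => e e0.
  have [e' e'0|k /= /gt_c kc tk] :=
    close t [set k | \val s < \val k <= \val y] _ e e0.
    have [k Ak ke] := t_adh _ e'0; exists k => //.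
    by rewrite ler0_norm ?subr_le0 ?t_lb// opprB ltrBlDl.
  by move: tk; rewrite ler_norml; lra.
exists s, t; split=> //; last exact: lt_trans ft.
split.
  rewrite lt_neqAle st andbT; apply/eqP => /val_inj st'.
  by move: ft; rewrite -st'; lra.
move=> k; have [ks|sk] := leP (\val k) (\val s); [by left|right].
have [ky|/ltW yk] := leP (\val k) (\val y); last exact: le_trans ty yk.
by apply: t_lb; rewrite /= sk.
Qed.

(** If the bound failed, [f] minus the linear function of slope [c] would increase from [x] to [y],
    hence between two adjacent points, against the hypothesis. *)
Lemma increment_le (f : K -> R) (L c : R) (x y : K) :
  (forall s t, `|f s - f t| <= L * `|\val s - \val t|) ->
  (forall s t, adjacent s t -> \val x <= \val s -> \val t <= \val y ->
    f t - f s <= c * (\val t - \val s)) ->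
  \val x <= \val y -> f y - f x <= c * (\val y - \val x).
Proof.
move=> fL fc xy; rewrite leNgt; apply/negP => lt_xy.
have [s t|//||s [t [st xs ty]]] :=
    @exists_adjacent_lt (fun k => f k - c * \val k) (L + `|c|) x y.
- rewrite mulrDl -normrM mulrBr.
  rewrite (_ : _ - _ = (f s - f t) - (c * \val s - c * \val t)); last by lra.
  by rewrite (le_trans (ler_normB _ _))// lerD2r.
- by lra.
- by have := fc _ _ st xs ty; lra.
Qed.

Lemma increment_norm_le (f : K -> R) (L c : R) (x y : K) :
  (forall s t, `|f s - f t| <= L * `|\val s - \val t|) ->
  (forall s t, adjacent s t -> \val x <= \val s -> \val t <= \val y ->
    `|f t - f s| <= c * (\val t - \val s)) ->
  \val x <= \val y -> `|f y - f x| <= c * (\val y - \val x).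
Proof.
move=> fL fc xy; rewrite ler_norml; apply/andP; split; last first.
  apply: (increment_le fL) => // s t st xs ty.
  by rewrite (le_trans (ler_norm _))// fc.
have := @increment_le (fun k => - f k) L c x y _ _ xy.
have -> : - f y - - f x = - (f y - f x) by lra.
rewrite lerNl; apply => [s t|s t st xs ty].
  by rewrite opprK addrC distrC.
by have := fc _ _ st xs ty; rewrite ler_norml; lra.
Qed.

End adjacent_points.

(** * Gaps as pairs of adjacent points *)

Section gap_enumeration.
Context {R : realType} (K : set R).
Hypothesis K_ge0 : forall x : R, K x -> 0 <= x.
Context (a b : nat -> K).
Hypothesis ab : gap_enum a b.

(** A component is nonempty, so the interval has positive length, and it misses [K]. *)
Lemma gap_enum_adjacent j : adjacent (a j) (b j).
Proof.
have [/(_ j I)[_ [x Ux jE]] _ _] := ab.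
have : `]\val (a j), \val (b j)[%classic x.
  by rewrite jE; exact: connected_component_refl.
rewrite /= in_itv/= => /andP[ax xb]; split; first exact: lt_trans xb.
move=> k; have [ka|ak] := leP (\val k) (\val (a j)); [by left|right].
rewrite leNgt; apply/negP => kb.
have : `]\val (a j), \val (b j)[%classic (\val k) by rewrite /= in_itv/= ak.
by rewrite jE => /connected_component_sub[_]; apply; exact/set_mem/valP.
Qed.

(** The interval between adjacent points is the component of its midpoint: a larger connected set
    would contain [s] or [t], which lie in [K]. *)
Lemma adjacent_gap_enum (s t : K) : adjacent s t ->
  exists j, a j = s /\ b j = t.
Proof.
move=> [st nK]; have [_ _ surj] := ab.
pose x := (\val s + \val t) / 2.
have sub : `]\val s, \val t[%classic `<=` hull0 K `\` K.
  move=> y; rewrite /= in_itv/= => /andP[sy yt]; split.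
    split; first by rewrite (le_trans _ (ltW sy))//;
      exact: K_ge0 (set_mem (valP s)).
    apply: le_ereal_sup_tmp; exists (\val t)%:E; last by rewrite lee_fin ltW.
    by exists (\val t) => //; exact/set_mem/valP.
  move=> Ky; have := nK (exist (fun v => v \in K) y (mem_set Ky)); move=> /=;
    lra.
have xI : `]\val s, \val t[%classic x by rewrite /= in_itv/= !midf_lt.
have compE : connected_component (hull0 K `\` K) x = `]\val s, \val t[%classic.
  apply/seteqP; split; last first.
    apply: connected_component_max => //.
    apply/connected_intervalP => y z; rewrite /= !in_itv/=.
    move=> /andP[sy _] /andP[_ zt] u /andP[yu uz].
    by rewrite in_itv/= (lt_le_trans sy)//= (le_lt_trans uz).
  have /= := xI; rewrite in_itv/= => /andP[sx xt].
  move=> y [C [Cx CU /connected_intervalP Cc] Cy]; rewrite /= in_itv/=.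
  apply/andP; split; rewrite ltNge; apply/negP => yx.
  - have /CU[_] : C (\val s) by apply: (Cc _ _ Cy Cx); rewrite yx ltW.
    by apply; exact/set_mem/valP.
  - have /CU[_] : C (\val t) by apply: (Cc _ _ Cx Cy); rewrite yx ltW.
    by apply; exact/set_mem/valP.
have [|j _ jE] := surj `]\val s, \val t[%classic.
  rewrite /= -compE; split; last by exists x => //; exact: sub.
  rewrite compE; exists (\val t); split; first by rewrite num_real.
  move=> M tM y; rewrite /= in_itv/= => /andP[sy yt].
  have s0 : 0 <= \val s by exact: K_ge0 (set_mem (valP s)).
  rewrite ger0_norm; first exact: le_trans (ltW yt) (ltW tM).
  exact: le_trans s0 (ltW sy).
have [abj _] := gap_enum_adjacent j.
(* The ends are recovered from the interval as its infimum and supremum. *)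
exists j; split; apply: val_inj.
  have : inf `]\val (a j), \val (b j)[%classic = inf `]\val s, \val t[%classic
    by rewrite jE.
  by rewrite !inf_itv// bnd_simp.
have : sup `]\val (a j), \val (b j)[%classic = sup `]\val s, \val t[%classic
  by rewrite jE.
by rewrite !sup_itv// bnd_simp.
Qed.

(** By adjacency a right end determines the left end, hence the whole gap. *)
Lemma gap_enum_inj i j : \val (b i) = \val (b j) -> i = j.
Proof.
move=> bij; have [_ inj _] := ab; apply: inj; rewrite ?inE//= bij.
have [abi ni] := gap_enum_adjacent i; have [abj nj] := gap_enum_adjacent j.
by have -> : \val (a i) = \val (a j) by have := ni (a j); have := nj (a i); lra.
Qed.

End gap_enumeration.

(** * Slopes across the gaps and membership in Dalet's space *)

Lemma finite_set_eventually (B : set nat) : finite_set B ->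
  \forall j \near \oo, ~ B j.
Proof.
move=> /finite_seqP[s ->]; exists (\max_(i <- s) i).+1 => // j /= sj js.
by have := @leq_bigmax_seq _ s xpredT id j js isT; rewrite leqNgt sj.
Qed.

Section gap_slopes.
Context {R : realType} (K : set R) (o : K).
Hypotheses (K_ge0 : forall x : R, K x -> 0 <= x) (K_countable : countable K).
Hypotheses (K_closed : closed K) (o0 : \val o = 0).
Context (a b : nat -> K).
Hypothesis ab : gap_enum a b.
Implicit Types f g : lip0 o.

Let val_ge0 (k : K) : 0 <= \val k.
Proof. exact: K_ge0 (set_mem (valP k)). Qed.

Definition gap_slope f j : R :=
  (f (b j) - f (a j)) / (\val (b j) - \val (a j)).

Lemma gap_length_gt0 j : 0 < \val (b j) - \val (a j).
Proof. by have [abj _] := gap_enum_adjacent ab j; rewrite subr_gt0. Qed.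

Lemma gap_incrementE f j :
  f (b j) - f (a j) = gap_slope f j * (\val (b j) - \val (a j)).
Proof. by rewrite /gap_slope divfK// gt_eqF// gap_length_gt0. Qed.

Lemma mdist_le_subr (x y : K) : \val x <= \val y -> mdist x y = \val y - \val x.
Proof. by move=> xy; rewrite mdist_subsetE distrC ger0_norm// subr_ge0. Qed.

Lemma mdist_base (x : K) : mdist o x = \val x.
Proof. by rewrite mdist_le_subr o0 ?subr0. Qed.

Lemma gap_slope_le_norm f j : `|gap_slope f j| <= `|f|.
Proof.
have L := gap_length_gt0 j.
rewrite /gap_slope normrM normfV (gtr0_norm L) ler_pdivrMr//.
by rewrite -[X in _ * X](gtr0_norm L); exact: lip0_norm_ub.
Qed.

Lemma increment_le_gap_slope (f : lip0 o) (c : R) (x y : K) :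
  (forall j, \val x <= \val (a j) -> \val (b j) <= \val y ->
    gap_slope f j <= c) ->
  \val x <= \val y -> f y - f x <= c * (\val y - \val x).
Proof.
move=> fc; apply: (increment_le K_countable K_closed (lip0_norm_ub f)) =>
  s t st.
have [j [<- <-]] := adjacent_gap_enum K_ge0 ab st => xa yb.
by rewrite gap_incrementE ler_wpM2r ?fc// ltW// gap_length_gt0.
Qed.

(** Only gaps between [x] and [y] are constrained; this localisation gives both the small-scale and
    the far-away condition of Dalet's space. *)
Lemma increment_norm_le_gap_slope (f : lip0 o) (c : R) (x y : K) :
  (forall j, \val x <= \val (a j) -> \val (b j) <= \val y ->
    `|gap_slope f j| <= c) ->
  \val x <= \val y -> `|f y - f x| <= c * (\val y - \val x).
Proof.
move=> fc; apply: (increment_norm_le K_countable K_closed (lip0_norm_ub f)) =>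
  s t st.
have [j [<- <-]] := adjacent_gap_enum K_ge0 ab st => xa yb.
have L := gap_length_gt0 j.
by rewrite gap_incrementE normrM (gtr0_norm L) ler_wpM2r ?fc// ltW.
Qed.

Lemma lip0_norm_le_gap_slope f (c : R) : 0 <= c ->
  (forall j, `|gap_slope f j| <= c) -> `|f| <= c.
Proof.
move=> c0 fc; apply: lip0_norm_le => // x y.
have H (s t : K) : \val s <= \val t -> `|f s - f t| <= c * mdist s t.
  move=> st; rewrite mdist_le_subr// distrC.
  exact: increment_norm_le_gap_slope.
have [xy|/ltW yx] := leP (\val x) (\val y); first exact: H.
by rewrite distrC metric_sym; exact: H.
Qed.

(** Right ends of gaps of length at least [d] are at least [d] apart, so the integer parts of
    [b j / d] are distinct; up to [r] there are finitely many. *)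
Lemma finite_long_gaps (d r : R) : 0 < d ->
  finite_set [set j | d <= \val (b j) - \val (a j) /\ \val (b j) <= r].
Proof.
move=> d0; set B := [set j | _].
pose phi j := Num.truncn (\val (b j) / d).
have b0 j : 0 <= \val (b j) / d.
  by rewrite divr_ge0// ltW.
have phi_lt i j : B i -> B j -> \val (b i) < \val (b j) -> phi i <> phi j.
  move=> [_ _] [dj _] bij pij.
  have [_ /(_ (b i))[ba|]] := gap_enum_adjacent ab j; last by rewrite leNgt bij.
  have := truncn_itv (b0 i); have := truncn_itv (b0 j);
    rewrite -/(phi _) -/(phi i) pij.
  move=> /andP[_ bj] /andP[bi _].
  have : \val (b i) / d + 1 <= \val (b j) / d.
    by rewrite -[X in _ + X](divff (lt0r_neq0 d0)) -mulrDl ler_wpM2r ?invr_ge0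
      ?(ltW d0)//; lra.
  by move: bj bi; rewrite -natr1; lra.
have phi_inj : {in B &, injective phi}.
  move=> i j; rewrite !inE => Bi Bj pij.
  apply: (gap_enum_inj ab); have [bij|bij|//] :=
    ltgtP (\val (b i)) (\val (b j)).
    by case: (phi_lt i j).
  by case: (phi_lt j i).
rewrite -(eq_finite_set (inj_card_eq phi_inj)).
apply: (@sub_finite_set _ _ `I_(Num.truncn (r / d)).+1) => [_ [j [_ bj] <-]|].
  by rewrite /= ltnS le_truncn// ler_wpM2r// invr_ge0 ltW.
exact: finite_II.
Qed.

(** All but finitely many gaps are shorter than [d] or end beyond [r]: the former are controlled by
    the little Lipschitz condition, the latter by flatness at infinity. *)
Lemma dalet_gap_slope_cvg0 f : f \in dalet o ->
  gap_slope f j @[j --> \oo] --> (0 : R).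
Proof.
move=> /asboolP[fl fi]; apply/cvgrPdist_le => e e0.
have [d d0 fd] := fl e e0.
have [r [r0]] : exists r : R, 0 <= r /\ `|0 - sup [set slope f p | p in
    [set p : K * K | (~ cball o r p.1 \/ ~ cball o r p.2) /\ p.1 != p.2]]| <= e.
  apply: (@filter_ex _ (pinfty_nbhs R)); near=> r; split; first by near: r;
    apply: nbhs_pinfty_ge; exact: num_real.
  by near: r; move/cvgrPdist_le : fi; exact.
rewrite sub0r normrN => fr.
have := finite_set_eventually (finite_long_gaps r d0); apply: filterS => j nB.
have L := gap_length_gt0 j;
  have abj : \val (a j) < \val (b j) by rewrite -subr_gt0.
rewrite sub0r normrN /gap_slope normrM normfV (gtr0_norm L) ler_pdivrMr//.
have mdE : mdist (b j) (a j) = \val (b j) - \val (a j).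
  by rewrite mdist_subsetE gtr0_norm.
have [/andP[jd jr]|] := boolP ((d <= \val (b j) - \val (a j)) && (\val (b j)
  <= r)).
  by case: nB.
rewrite negb_and -!ltNge => /orP[jd|rj].
  by rewrite -mdE; apply: fd; rewrite mdE L.
rewrite -mdE -ler_pdivrMr ?mdE// -mdE (le_trans _ (le_trans (ler_norm _) fr))//.
apply: (@sup_image_ub _ _ _ (slope f) `|f| (b j, a j)) => [p _|].
  exact: slope_le_norm.
split; last by apply/eqP => /= baj; rewrite baj ltxx in abj.
by left; rewrite /cball/= mdist_base; apply/negP; rewrite -ltNge.
Unshelve. all: by end_near. Qed.

(** Ensures that points closer than [d] have none of the first [N] gaps between them. *)
Lemma gap_length_min N : exists2 d : R, 0 < d &
  forall j, (j < N)%N -> d <= \val (b j) - \val (a j).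
Proof.
elim: N => [|N [d d0 dN]]; first by exists 1.
exists (Num.min d (\val (b N) - \val (a N))).
  by rewrite lt_min d0 gap_length_gt0.
move=> j; rewrite ltnS leq_eqVlt => /orP[/eqP->|/dN dj].
  by rewrite ge_min lexx orbT.
by rewrite ge_min dj.
Qed.

(** None of the first [N] gaps lies beyond [m], which is taken in [K] so that increments of [f] can
    be split at it. *)
Lemma gap_right_max N : exists m : K,
  forall j, (j < N)%N -> \val (b j) <= \val m.
Proof.
elim: N => [|N [m mN]]; first by exists o.
have [bm|mb] := leP (\val (b N)) (\val m).
  by exists m => j; rewrite ltnS leq_eqVlt => /orP[/eqP->|/mN].
exists (b N) => j; rewrite ltnS leq_eqVlt => /orP[/eqP->//|/mN jm].
exact: le_trans jm (ltW mb).
Qed.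

(** Only finitely many gaps have a large slope. Close points have none of them in between; for a far
    point their bounded contribution is outweighed by the distance. *)
Lemma gap_slope_cvg0_dalet f : gap_slope f j @[j --> \oo] --> (0 : R) ->
  f \in dalet o.
Proof.
move=> f0.
have tail e : 0 < e -> exists N, forall j, (N <= j)%N -> `|gap_slope f j| <= e.
  move=> e0; have /cvgrPdist_le/(_ e e0)[N _ NP] := f0.
  by exists N => j /NP; rewrite sub0r normrN.
apply/asboolP; split.
  move=> e e0; have [N NP] := tail _ e0; have [d d0 dP] := gap_length_min N.
  exists d => //.
  have H (x y : K) : \val x <= \val y -> mdist x y < d ->
    `|f x - f y| <= e * mdist x y.
    move=> xy; rewrite mdist_le_subr// => xyd.
    rewrite distrC; apply: increment_norm_le_gap_slope => // j xa yb.
    apply: NP; rewrite leqNgt; apply/negP => /dP; lra.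
  move=> x y /andP[_ xyd]; have [xy|/ltW yx] := leP (\val x) (\val y).
    exact: H.
  by rewrite distrC metric_sym; apply: H => //; rewrite metric_sym.
apply/cvgrPdist_le => e e0.
have e2 : 0 < e / 2 by rewrite divr_gt0.
have [N NP] := tail _ e2; have [m mP] := gap_right_max N.
have m0 : 0 <= \val m by exact: val_ge0.
near=> r.
(* If either point lies outside the ball, so does the larger one, here [y]. *)
have H (x y : K) : \val x < \val y -> r < \val y ->
    `|f x - f y| / mdist x y <= e.
  move=> xy ry.
  have mdE := mdist_le_subr (ltW xy).
  rewrite mdE ler_pdivrMr ?subr_gt0//.
  have beyond (z : K) : \val m <= \val z -> \val z <= \val y ->
      `|f y - f z| <= e / 2 * (\val y - \val z).
    move=> mz zy; apply: increment_norm_le_gap_slope => // j za jy.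
    apply: NP; rewrite leqNgt; apply/negP => /mP jm.
    have := gap_length_gt0 j; lra.
  rewrite distrC; have [mx|xm] := leP (\val m) (\val x).
    rewrite (le_trans (beyond _ mx (ltW xy)))//
      ler_wpM2r ?subr_ge0 ?(ltW xy)//; lra.
  have mr : \val m <= r by near: r; apply: nbhs_pinfty_ge; exact: num_real.
  (* [r] is so large that the increment below [m], at most the norm of [f] times [m], fits into the
     other half of [e]. *)
  have fr : `|f| * \val m <= e / 2 * (r - \val m).
    rewrite -ler_pdivrMl// lerBrDr; near: r; apply: nbhs_pinfty_ge;
      exact: num_real.
  have x0 : 0 <= \val x by exact: val_ge0.
  rewrite -(subrK (f m) (f y)) -addrA (le_trans (ler_normD _ _))//.
  have my : \val m <= \val y by exact: le_trans mr (ltW ry).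
  have := beyond m (lexx _) my.
  have := lip0_norm_ub f m x; rewrite metric_sym mdist_le_subr ?(ltW xm)//.
  have : `|f| * (\val m - \val x) <= `|f| * \val m by rewrite ler_wpM2l// gerBl.
  have : e / 2 * (\val y - \val m) <= e / 2 * (\val y - \val x)
    by rewrite ler_wpM2l//; lra.
  have : e / 2 * (r - \val m) <= e / 2 * (\val y - \val x)
    by rewrite ler_wpM2l//; lra.
  lra.
rewrite sub0r normrN ger0_norm; last first.
  apply: (@sup_image_ge0 _ _ _ _ `|f|) => p _; rewrite slope_le_norm andbT.
  by rewrite divr_ge0// mdist_ge0.
apply: sup_image_le => [|[x y]/= [out xy]]; first exact: ltW.
have cballE (z : K) : ~ cball o r z -> r < \val z.
  by move=> /negP; rewrite -ltNge mdist_base.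
have [xy'|yx|/val_inj xyE] := ltgtP (\val x) (\val y);
  last by rewrite xyE eqxx in xy.
  apply: H => //; case: out => /cballE// rx; exact: lt_trans xy'.
rewrite /slope/= distrC metric_sym; apply: H => //.
by case: out => /cballE// rx; exact: lt_trans yx.
Unshelve. all: by end_near. Qed.

Lemma Egap_dalet : Egap o a b =i dalet o.
Proof.
move=> f; apply/idP/idP => [/asboolP|/dalet_gap_slope_cvg0 f0].
  exact: gap_slope_cvg0_dalet.
exact/asboolP.
Qed.

End gap_slopes.

(** * Step functions and the expansion of a Lipschitz function along the gaps *)

Section gap_steps.
Context {R : realType} (K : set R) (o : K).
Hypotheses (K_ge0 : forall x : R, K x -> 0 <= x) (K_countable : countable K).
Hypotheses (K_closed : closed K) (o0 : \val o = 0).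
Context (a b : nat -> K).
Hypothesis ab : gap_enum a b.
Implicit Types f g : lip0 o.
Local Notation gap_slope := (gap_slope a b).

Let val_ge0 (k : K) : 0 <= \val k.
Proof. exact: K_ge0 (set_mem (valP k)). Qed.

Let step j (x : K) : R :=
  if \val (b j) <= \val x then \val (b j) - \val (a j) else 0.

Let step_base j : step j o = 0.
Proof.
rewrite /step ifF//; apply/negbTE; rewrite -ltNge o0.
have [abj _] := gap_enum_adjacent ab j.
exact: le_lt_trans abj.
Qed.

(** If the jump occurs between [s] and [t], the whole gap lies between them, so the jump is at most
    their distance. *)
Let step_lip j x y : `|step j x - step j y| <= 1 * mdist x y.
Proof.
have H (s t : K) : \val s <= \val t -> `|step j s - step j t| <= 1 * mdist s t.
  move=> st; rewrite mul1r mdist_le_subr// /step.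
  have [bs|sb] := leP (\val (b j)) (\val s).
    by rewrite (le_trans bs st) subrr normr0 subr_ge0.
  have [bt|tb] := leP (\val (b j)) (\val t);
    last by rewrite subrr normr0 subr_ge0.
  have L := gap_length_gt0 ab j.
  have [_ /(_ s)[sa|]] := gap_enum_adjacent ab j; last by rewrite leNgt sb.
  by rewrite sub0r normrN gtr0_norm//; lra.
have [xy|/ltW yx] := leP (\val x) (\val y); first exact: H.
by rewrite distrC metric_sym; exact: H.
Qed.

Definition gap_step j : lip0 o :=
  Lip0 (lip0_of_bound (step_base j) (step_lip j)).

Lemma gap_stepE j (x : K) : gap_step j x =
  if \val (b j) <= \val x then \val (b j) - \val (a j) else 0.
Proof. by []. Qed.

(** Biorthogonality of slopes and steps: for distinct gaps, the jump point [b j] never falls between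
    the ends of the [i]-th gap, nor on its right end. *)
Lemma gap_slope_step i j : gap_slope (gap_step j) i = (i == j)%:R.
Proof.
rewrite /gap_slope !gap_stepE.
have [abi ni] := gap_enum_adjacent ab i;
  have [abj nj] := gap_enum_adjacent ab j.
have [->|/eqP ij] := eqVneq i j.
  by rewrite lexx ifF ?subr0 ?divff// ?gt_eqF ?subr_gt0//; apply/negbTE;
    rewrite -ltNge.
have [bji|bij] := leP (\val (b j)) (\val (b i)).
  have [bja|aib] := leP (\val (b j)) (\val (a i)); first by rewrite subrr mul0r.
  case: ij; apply: (gap_enum_inj ab).
  by have [bj|bj] := ni (b j); lra.
rewrite ifF ?subrr ?mul0r//; apply/negbTE; rewrite -ltNge.
exact: lt_trans bij.
Qed.

Lemma gap_slopeP (l : R) f g j :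
  gap_slope (l *: f + g) j = l * gap_slope f j + gap_slope g j.
Proof.
rewrite /gap_slope mulrA -mulrDl; congr (_ / _).
rewrite [LHS](_ : _ = l * f (b j) + g (b j) - (l * f (a j) + g (a j)))//.
by rewrite mulrBr opprD addrACA.
Qed.

Lemma gap_slopeB f g j : gap_slope (f - g) j = gap_slope f j - gap_slope g j.
Proof. by rewrite -scaleN1r addrC gap_slopeP mulN1r addrC. Qed.

Lemma gap_slope0 j : gap_slope (0 : lip0 o) j = 0.
Proof. by rewrite /gap_slope [X in X / _](_ : _ = 0 - 0 :> R)//
  subrr mul0r. Qed.

Definition gap_comb (c : nat -> R) n : lip0 o :=
  \sum_(0 <= i < n) c i *: gap_step i.

Lemma gap_comb0 c : gap_comb c 0 = 0.
Proof. by rewrite /gap_comb big_nil. Qed.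

Lemma gap_combS c n : gap_comb c n.+1 = c n *: gap_step n + gap_comb c n.
Proof. by rewrite /gap_comb big_nat_recr//= addrC. Qed.

Lemma gap_slope_comb c n j :
  gap_slope (gap_comb c n) j = if (j < n)%N then c j else 0.
Proof.
elim: n => [|n IHn]; first by rewrite gap_comb0 gap_slope0.
rewrite gap_combS gap_slopeP IHn gap_slope_step ltnS [in RHS]leq_eqVlt.
by have [->|_] := eqVneq j n; rewrite ?ltnn/= ?mulr1 ?addr0// mulr0 add0r.
Qed.

Lemma gap_comb_dalet c n : gap_comb c n \in dalet o.
Proof.
apply: (gap_slope_cvg0_dalet K_ge0 K_countable K_closed o0 ab).
apply: cvg_near_cst; exists n => // j /= nj.
by rewrite gap_slope_comb ltnNge nj.
Qed.

Lemma gap_comb_norm_le c n (C : R) : 0 <= C ->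
  (forall j, `|c j| <= C) -> `|gap_comb c n| <= C.
Proof.
move=> C0 cC; apply: (lip0_norm_le_gap_slope K_ge0 K_countable K_closed ab) =>
  // j.
by rewrite gap_slope_comb; case: ifP; rewrite ?normr0.
Qed.

Let coord_lip0 : (\val : K -> R) \in lip0_pred o.
Proof. by apply: (@lip0_of_bound _ _ _ _ 1) => // x y; rewrite mul1r. Qed.

Let coord : lip0 o := Lip0 coord_lip0.

Let gap_slope_coord j : gap_slope coord j = 1.
Proof.
by rewrite /gap_slope [X in X / _](_ : _ = \val (b j) - \val (a j))// divff//
  gt_eqF ?gap_length_gt0.
Qed.

(** Its value at [x] is the length of [0, x] not covered by the first [n] gaps; it will dominate the
    error of the [n]-th partial sum of any [f], up to the norm of [f]. *)
Let remainder n : lip0 o := coord - gap_comb (fun=> 1) n.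

Let gap_slope_remainder n j : gap_slope (remainder n) j = if (j < n)%N then 0
  else 1.
Proof. by rewrite gap_slopeB gap_slope_coord gap_slope_comb; case: ifP;
  rewrite ?subrr ?subr0. Qed.

Let remainder_mono n (x y : K) : \val x <= \val y ->
  remainder n x <= remainder n y.
Proof.
(* The available bound on increments is an upper one, so it is applied to the negative, whose slopes
   are 0 or -1. *)
move=> xy; have := @increment_le_gap_slope _ _ o K_ge0 K_countable K_closed _
  _ ab (0 - remainder n) 0 x y.
rewrite mul0r [(0 - remainder n : lip0 o) y](_ : _ = 0 - remainder n y)//.
rewrite [(0 - remainder n : lip0 o) x](_ : _ = 0 - remainder n x)// => H.
suff : 0 - remainder n y - (0 - remainder n x) <= 0 by lra.
apply: H => // j _ _; rewrite gap_slopeB gap_slope0 gap_slope_remainder.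
by case: ifP => _; lra.
Qed.

Let remainder_ge0 n (x : K) : 0 <= remainder n x.
Proof. by rewrite -(lip0_base (remainder n)) remainder_mono// o0. Qed.

(* K being null, the gaps below x fill up all of [0, x]: the remaining length
   decreases to a Lipschitz function of x that is constant across every gap. *)
Let remainder_cvg0 (x : K) : remainder n x @[n --> \oo] --> (0 : R).
Proof.
have rcvg (y : K) : cvgn (fun n => remainder n y).
  apply: nonincreasing_is_cvgn; last by exists 0 => _ [n _ <-].
  apply/nonincreasing_seqP => n; rewrite /remainder gap_combS scale1r.
  rewrite [leLHS](_ : _ = remainder n y - gap_step n y); last first.
    rewrite [LHS](_ : _ = coord y - (gap_step n y + gap_comb (fun=> 1) n y))//.
    rewrite [remainder n y](_ : _ = coord y - gap_comb (fun=> 1) n y)//; lra.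
  rewrite gerBl gap_stepE; case: ifP => // _.
  by rewrite ltW ?gap_length_gt0.
pose v (y : K) : R := limn (fun n => remainder n y).
have v_lip y z : `|v y - v z| <= 1 * mdist y z.
  have : `|remainder n y - remainder n z| @[n --> \oo] --> `|v y - v z|.
    by apply: cvg_norm; apply: cvgB; exact: rcvg.
  move=> vyz; apply: (cvgr_to_le vyz).
  near=> n; rewrite (le_trans (lip0_norm_ub _ _ _))// ler_wpM2r ?mdist_ge0//.
  apply: (lip0_norm_le_gap_slope K_ge0 K_countable K_closed ab) => // j.
  by rewrite gap_slope_remainder; case: ifP; rewrite ?normr0 ?normr1.
have v0 : v o = 0.
  rewrite /v [X in limn X](_ : _ = cst 0); first exact: lim_cst.
  by apply/funext => n; rewrite lip0_base.
have v_gap j : v (b j) - v (a j) = 0.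
  have : remainder n (b j) - remainder n (a j) @[n --> \oo] --> v (b j) - v (a
    j).
    by apply: cvgB; exact: rcvg.
  move=> vab; rewrite -(cvg_lim _ vab)//; apply: lim_near_cst => //.
  (* From [n = j.+1] on, the [j]-th gap has been subtracted. *)
  exists j.+1 => // n /= jn.
  by rewrite (gap_incrementE ab) gap_slope_remainder jn mul0r.
have vP : v \in lip0_pred o by exact: lip0_of_bound v0 v_lip.
suff vx : v x = 0 by rewrite -vx; exact: rcvg.
have := @increment_norm_le_gap_slope _ _ o K_ge0 K_countable K_closed _ _ ab
  (Lip0 vP) 0 o x.
rewrite mul0r [X in `|X|](_ : _ = v x - v o)// v0 subr0 normr_le0 o0 => H.
apply/eqP; apply: H => // j _ _;
  rewrite /gap_slope [X in X / _](_ : _ = v (b j) - v (a j))//.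
by rewrite v_gap mul0r normr0.
Unshelve. all: by end_near. Qed.

(** The error has slope 0 across the first [n] gaps and at most the norm of [f] across the others,
    so the norm of [f] times [remainder n] dominates it. *)
Lemma gap_comb_cvg f x : gap_comb (gap_slope f) n x @[n --> \oo] --> f x.
Proof.
have bound n : `|f x - gap_comb (gap_slope f) n x| <= `|f| * remainder n x.
  (* One-sided comparison: the difference of both sides has slopes of constant sign and vanishes at
     [o]. *)
  have H (g : lip0 o) : (forall j, gap_slope g j <= if (j < n)%N then 0 else
    `|f|) ->
      g x <= `|f| * remainder n x.
    move=> gf; have := @increment_le_gap_slope _ _ o K_ge0 K_countable
      K_closed _ _ ab
      (- `|f| *: remainder n + g) 0 o x.
    rewrite mul0r !lip0_base o0 subr0.
    rewrite [(_ + g : lip0 o) x](_ : _ = - `|f| * remainder n x + g x)//.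
    move=> L; suff : - `|f| * remainder n x + g x <= 0 by lra.
    apply: L => // j _ _; rewrite gap_slopeP gap_slope_remainder.
    by have := gf j; case: ifP => _; lra.
  have bnd j := gap_slope_le_norm ab f j.
  rewrite ler_norml; apply/andP; split.
    rewrite lerNl opprB.
    apply: (H (gap_comb (gap_slope f) n - f)) => j.
    rewrite gap_slopeB gap_slope_comb; have := bnd j; rewrite ler_norml.
    by case: ifP => _; lra.
  apply: (H (f - gap_comb (gap_slope f) n)) => j.
  rewrite gap_slopeB gap_slope_comb; have := bnd j; rewrite ler_norml.
  by case: ifP => _; lra.
have lim0 : `|f| * remainder n x @[n --> \oo] --> (0 : R).
  by rewrite -[X in _ --> X](mulr0 `|f|); apply: cvgMr; exact: remainder_cvg0.
apply/cvgrPdist_le => e e0; move/cvgrPdist_le : lim0 => /(_ e e0).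
apply: filterS => n; rewrite sub0r normrN; apply: le_trans.
exact: le_trans (bound n) (ler_norm _).
Qed.

End gap_steps.

(** * Duality between Dalet's space and the free space *)

Section duality.
Context {R : realType} (K : set R) (o : K).
Hypotheses (K_ge0 : forall x : R, K x -> 0 <= x) (K_countable : countable K).
Hypotheses (K_closed : closed K) (o0 : \val o = 0).
Context (a b : nat -> K).
Hypothesis ab : gap_enum a b.
Local Notation gap_slope := (gap_slope a b).
Local Notation gap_step := (gap_step K_ge0 o0 ab).
Local Notation gap_comb := (gap_comb K_ge0 o0 ab).

Definition dalet_comb (c : nat -> R) n : dalet_space o :=
  NormedSubspace (gap_comb_dalet K_ge0 K_countable K_closed o0 ab c n).

Lemma norm_free_restriction (eta : lipfree o) : `|free_restriction o eta| =
  `|eta|.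
Proof.
apply/eqP; rewrite eq_le; apply/andP; split.
  apply: clin_norm_le => // f.
  exact: (clin_norm_ub (normed_subspace_val eta) (normed_subspace_val f)).
suff H (f : lip0 o) : `|clin_fun (normed_subspace_val eta) f| <=
    `|free_restriction o eta| * `|f|.
  by apply: clin_norm_le => // f; exact: H.
have comb_le n : `|gap_comb (gap_slope f) n| <= `|f|.
  exact: gap_comb_norm_le (normr_ge0 f) (gap_slope_le_norm ab f).
(* Bounded pointwise convergence suffices because [eta] lies in the free space; the partial sums
   need not converge to [f] in norm. *)
have cvg_eta := free_pointwise_cvg (eta := eta) comb_le
  (fun x => gap_comb_cvg K_ge0 K_countable K_closed o0 ab (f := f) (x := x)).
apply: (cvgr_to_le (cvg_norm cvg_eta)); apply: nearW => n.
apply: (le_trans (clin_norm_ub (free_restriction o eta) (dalet_comb (gap_slope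
  f) n))).
by rewrite ler_wpM2l//; exact: comb_le.
Qed.

Section preimage.
Variable phi : dual R (dalet_space o).

(** This is phi(h_j): indicator coefficients with length [j.+1], just enough to include index [j],
    reproduce h_j inside Dalet's space. *)
Let weight j : R := phi (dalet_comb (fun i => (i == j)%:R) j.+1).

Let phi_comb c n : phi (dalet_comb c n) = \sum_(0 <= j < n) c j * weight j.
Proof.
elim: n => [|n IHn].
  rewrite big_nil [dalet_comb c 0](_ : _ = 0) ?clin0//.
  by apply: val_inj; exact: gap_comb0.
rewrite big_nat_recr//= -IHn addrC.
rewrite [dalet_comb c n.+1](_ : _ = c n *: dalet_comb (fun i =>
  (i == n)%:R) n.+1 + dalet_comb c n).
  by rewrite clin_linear.
apply: val_inj; rewrite /= !gap_combS eqxx scale1r.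
rewrite [gap_comb (fun i => (i == n)%:R) n](_ : _ = 0) ?addr0//.
apply: big1_seq => i /andP[_]; rewrite mem_index_iota => /andP[_ ltin].
by rewrite ltn_eqF// scale0r.
Qed.

(** [phi] is tested on the combination with the signs of the weights as coefficients, whose norm is
    at most 1. *)
Let sum_weight_le n : \sum_(0 <= j < n) `|weight j| <= `|phi|.
Proof.
have -> : \sum_(0 <= j < n) `|weight j| = phi (dalet_comb (fun j =>
  Num.sg (weight j)) n).
  by rewrite phi_comb; apply: eq_bigr => j _; rewrite normrEsg.
rewrite (le_trans (ler_norm _))// (le_trans (clin_norm_ub _ _))// ler_piMr//.
apply: gap_comb_norm_le => // j.
by rewrite normr_sg; case: eqP.
Qed.

Let total := limn (series (fun j => `|weight j|)).

Let weight_nd : {homo series (fun j =>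
  `|weight j|) : n m / (n <= m)%N >-> n <= m}.
Proof.
by apply/nondecreasing_seqP => n; rewrite /series/= big_nat_recr//= lerDl.
Qed.

Let weight_cvg : cvgn (series (fun j => `|weight j|)).
Proof.
apply: nondecreasing_is_cvgn => //.
by exists `|phi| => _ [n _ <-]; exact: sum_weight_le.
Qed.

Let term (f : lip0 o) j := weight j * gap_slope f j.

Let term_le f j : `|term f j| <= `|f| * `|weight j|.
Proof. by rewrite normrM mulrC ler_wpM2r// gap_slope_le_norm. Qed.

Let term_cvg f : cvgn (series (term f)).
Proof.
apply: normed_cvg; apply: nondecreasing_is_cvgn.
  by apply/nondecreasing_seqP => n; rewrite /= /series/= big_nat_recr//= lerDl.
exists (`|f| * `|phi|) => _ [n _ <-]; rewrite /= /series/=.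
apply: (@le_trans _ _ (\sum_(0 <= j < n) `|f| * `|weight j|)).
  by apply: ler_sum => j _.
by rewrite -mulr_sumr ler_wpM2l.
Qed.

(** Extends [phi] to all Lipschitz functions: bounded slopes against summable weights converge even
    when the slopes do not tend to 0. *)
Let pre (f : lip0 o) : R := limn (series (term f)).

Let pre_linear : linear pre.
Proof.
move=> l f g; apply: cvg_lim => //.
have -> : series (term (l *: f + g)) = (fun n =>
  l *: series (term f) n + series (term g) n).
  apply/funext => n; rewrite /series/= scaler_sumr -big_split/=;
    apply: eq_bigr => j _.
  by rewrite /term gap_slopeP mulrDr mulrCA.
by apply: cvgD; [apply: cvgZr; exact: term_cvg|exact: term_cvg].
Qed.

(** Uniform over the unit ball: [n = 0] bounds the norm of [pre], and large [n] gives norm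
    convergence of the partial sums. *)
Let pre_tail f n : `|pre f - series (term f) n| <= (total - series (fun j =>
  `|weight j|) n) * `|f|.
Proof.
have : `|series (term f) m - series (term f) n| @[m --> \oo] --> `|pre f -
  series (term f) n|.
  by apply: cvg_norm; apply: cvgB; [exact: term_cvg|exact: cvg_cst].
move=> pre_cvg; apply: (cvgr_to_le pre_cvg); exists n => // m /= nm.
have W := nondecreasing_cvgn_le weight_nd weight_cvg m.
apply: (@le_trans _ _ ((series (fun j => `|weight j|) m - series (fun j =>
  `|weight j|) n) * `|f|)).
  rewrite !sub_series_geq// mulr_suml (le_trans (ler_norm_sum _ _ _))//.
  by apply: ler_sum => j _; rewrite mulrC.
by rewrite ler_wpM2r// lerB.
Qed.

Let pre_clin : pre \in @clin_pred R (lip0 o) R.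
Proof.
apply: (@bounded_clin _ _ _ _ total) => // f.
by have := pre_tail f 0; rewrite /series/= !big_geq// !subr0.
Qed.

(** A weighted sum of the elementary molecules of the gaps, each of which evaluates a function to
    its slope. *)
Let partial n : lipfree o := \sum_(0 <= j < n)
  (weight j / (\val (b j) - \val (a j))) *: (free_delta o (b j) - free_delta o
    (a j)).

Let partialE n f : clin_fun (normed_subspace_val (partial n)) f = series (term
  f) n.
Proof.
rewrite -lip0_dualE clin_sum /series/=; apply: eq_bigr => j _.
by rewrite clinZ clinB /term /gap_slope mulrA mulrAC.
Qed.

Let pre_free : Clin pre_clin \in closed_span (range (delta o)).
Proof.
(* Passing to the double closure lets the approximants be taken in the closed span, where the
   partial sums are known to lie. *)
rewrite inE (_ : closure _ = closure (closure (linear_span (range (delta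
  o))))); last first.
  by apply/closure_id; exact: closed_closure.
move=> B /nbhs_ballP[e /= e0 eB].
have /cvgrPdist_lt/(_ e e0)[n _ /(_ n (leqnn n)) ne] := weight_cvg.
exists (\val (partial n)); split; first exact/set_mem/valP.
apply: eB; rewrite -ball_normE/=; apply: le_lt_trans ne.
apply: clin_norm_le => // f.
rewrite [X in `|X|](_ : _ = pre f - series (term f) n);
  last by rewrite -partialE.
by rewrite (le_trans (pre_tail f n))// ler_wpM2r// ler_norm.
Qed.

(** On Dalet's space the partial sums converge to [f] in norm, so [phi] at [f] is the sum of the
    series defining [pre]. *)
Lemma free_restriction_surj : exists eta, free_restriction o eta = phi.
Proof.
exists (NormedSubspace pre_free); apply: clin_inj => f.
have f0 := dalet_gap_slope_cvg0 K_ge0 o0 ab (valP f).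
rewrite [LHS](_ : _ = pre (\val f))//; apply: cvg_lim => //.
rewrite [X in X @ _](_ : _ = fun n =>
  phi (dalet_comb (gap_slope (\val f)) n)); last first.
  by apply/funext => n; rewrite phi_comb; apply: eq_bigr => j _; rewrite mulrC.
suff comb_cvg : dalet_comb (gap_slope (\val f)) n @[n --> \oo] --> f.
  exact: (continuous_cvg _ (@clin_continuous _ _ _ phi f) comb_cvg).
apply/cvgrPdist_le => e e0; move/cvgrPdist_le : f0 => /(_ e e0)[N _ NP].
exists N => // n /= Nn.
(* The difference retains only the slopes of index at least [n], which are small. *)
apply: (lip0_norm_le_gap_slope K_ge0 K_countable K_closed ab); first exact: ltW.
move=> j; rewrite [\val _](_ : _ = \val f - gap_comb (gap_slope (\val f)) n)//.
rewrite gap_slopeB gap_slope_comb; case: ltnP => jn;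
  first by rewrite subrr normr0 ltW.
by rewrite subr0 -normrN -sub0r; apply: NP => /=; exact: leq_trans jn.
Qed.

End preimage.

Lemma isometric_isomorphism_free_restriction :
  isometric_isomorphism (free_restriction o).
Proof.
apply: isometric_isomorphism_clin norm_free_restriction _ => phi.
exact: free_restriction_surj.
Qed.

End duality.

Theorem theorem5p3 (R : realType) (K : set R) (o : K)
    (K_ge0 : forall x : R, K x -> 0 <= x)
    (K_infinite : infinite_set K) (K_countable : countable K)
    (K_closed : closed K) (o0 : \val o = 0) :
  [/\ forall a b : nat -> K, gap_enum a b -> Egap o a b =i dalet o,
      isometric_isomorphism (free_restriction o),
      isometric_isomorphism (adjoint (free_restriction o)) &
      exists Phi : dual R (dual R (dalet_space o)) -> lip0 o,
        isometric_isomorphism Phi /\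
        forall xi, lip0_dual (Phi xi) = adjoint (free_restriction o) xi].
Proof.
have K0 : K 0 by rewrite -o0; exact: set_mem (valP o).
(* The duality claims do not mention gaps, so one enumeration serves to prove them. *)
have [a [b ab]] := gap_enum_exists K_ge0 K0 K_infinite K_countable K_closed.
have res := isometric_isomorphism_free_restriction K_ge0 K_countable K_closed
  o0 ab.
have adj := isometric_isomorphism_adjoint res.
have lip := @isometric_isomorphism_lip0_dual R K o.
have [S [SK KS]] := @isometric_isomorphism_inv R _ _ (Clin (lip0_dual_subproof
  o)) lip.
split=> //; first by move=> c d cd; exact: Egap_dalet.
(* The adjoint takes values in the dual of the free space; [S], the inverse of the canonical
   identification, brings them back to functions. *)
exists (clin_comp S (adjoint (free_restriction o))); split; last by move=> xi;
  exact: KS.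
apply: isometric_isomorphism_comp adj.
exact: (isometric_isomorphism_sym (T := Clin (lip0_dual_subproof o)) lip KS).
Qed.
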